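(* Let $K\subset\mathbb{C}$ be a compact set such that $\mathbb{C}\setminus K$ is connected, and let $z\in K$. The following are equivalent: (1) $z\in\partial K$; (2) $z$ is a peak point for $A(K)$; (3) $z$ satisfies the Bishop $\frac14-\frac34$ property.
   Context: $A(K)$ is the uniform algebra of all complex-valued functions continuous on $K$ and holomorphic on $\mathrm{int}(K)$, with the sup norm $\|\cdot\|_K$; $\partial K$ is the topological boundary of $K$ in $\mathbb{C}$. A point $z\in K$ is a peak point for $A(K)$ if there exists $f\in A(K)$ with $f(z)=1$ and $|f(w)|<1$ for all $w\in K\setminus\{z\}$. A point $z\in K$ satisfies the Bishop $\frac14-\frac34$ property if for every open neighborhood $U$ of $z$ there exists $f\in A(K)$ such that $\|f\|_K\le 1$, $f(z)$ is real with $f(z)>\frac34$, and $|f(w)|<\frac14$ for all $w\in K\setminus U$. *)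

(* Defs.v *)
From mathcomp Require Import all_boot all_order all_algebra.
From mathcomp Require Import complex.
From mathcomp Require Import boolp classical_sets reals topology normedtype derive.

Set Implicit Arguments.
Unset Strict Implicit.
Unset Printing Implicit Defensive.

Import Order.TTheory GRing.Theory Num.Theory.
Import numFieldNormedType.Exports.

Local Open Scope classical_set_scope.
Local Open Scope ring_scope.

(* Typing R[i] as a [numClosedFieldType] lets inference find the topology of
   its modulus and its structure of normed module over itself.  Its order is
   the partial one (x <= y iff y - x is a nonnegative real) and `|x| lies in
   Cplx R; the modulus with values in R is [Normc.normc]. *)
Definition Cplx (R : realType) : numClosedFieldType := R[i].

Definition boundary (T : topologicalType) (A : set T) : set T :=
  closure A `\` interior A.

Section AlgebraA.
Variable R : realType.
Local Notation C := (Cplx R).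
Implicit Types (K U : set C) (f : C -> C) (z w : C).

(* [derivable f w 1] has increments h ranging over the scalar field C, so it is
   complex differentiability. *)
Definition holomorphic_on U f : Prop := forall w, U w -> derivable f w 1.

(* A function on K is represented by a total function on C; neither condition
   depends on its values outside K. *)
Definition algA K : set (C -> C) :=
  [set f | {within K, continuous f} /\ holomorphic_on (interior K) f].

(* [sup] is 0 on unbounded or empty sets; for f in A(K) with K compact and
   nonempty this is the true supremum. *)
Definition supnorm K f : R := sup [set Normc.normc (f w) | w in K].

Definition peak_point K z : Prop :=
  K z /\ exists2 f, algA K f &
    f z = 1 /\ (forall w, (K `\ z) w -> `|f w| < 1).

Definition bishop_quarter K z : Prop :=
  K z /\ forall U, open_nbhs z U ->
    exists2 f, algA K f &
      [/\ supnorm K f <= 1,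
          f z \is Num.real,
          3 / 4 < f z &
          forall w, (K `\` U) w -> `|f w| < 1 / 4].

End AlgebraA.

(* Main.v *)
(** For [z] in the boundary, choose [a], [b] outside [K] near [z], with [a] much closer
    to [z] than [b], such that [(w - a) / (w - b)] has a square root [s] which is continuous
    on [K] and has positive real part far from [z]. Such pairs exist because, within a small
    disk around [z], the relation "there is such an [s]" has open classes outside [K], so that
    connectedness of the complement lets [b] run from [a] to the rim of the disk. The Cayley
    transform [(1 - s) / (1 + s)] is bounded on [K] by an absolute constant, is small away
    from [z], and is bounded below at [z]. A Bishop series [sum (1 - l) l^n f_n] of such
    functions, concentrated at faster and faster shrinking scales, peaks at [z]; it can be
    differentiated term by term because the [f_n] are uniformly Lipschitz away from [z].

    Powers of a peak function give the 1/4-3/4 property. An interior point cannot have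
    it, since [Re f] at the center of a disk is at most its maximum on the circle: Goursat's
    lemma for [f (z + exp zeta)] on a rectangle of height [2 pi] shows that circular
    means do not depend on the radius. *)
Require Import Defs.
From mathcomp Require Import all_boot all_order all_algebra.
From mathcomp Require Import complex.
From mathcomp Require Import boolp classical_sets reals topology normedtype derive.
From mathcomp Require Import sequences ereal measure lebesgue_measure.
From mathcomp Require Import lebesgue_integral ftc exp trigo.
From mathcomp Require Import ring lra.
Set Implicit Arguments.
Unset Strict Implicit.
Unset Printing Implicit Defensive.
Import Order.TTheory GRing.Theory Num.Theory.
Import numFieldNormedType.Exports.
Local Open Scope classical_set_scope.

(** * The modulus, continuity and differentiability in terms of epsilon and delta *)

Section Modulus.
Local Open Scope ring_scope.
Variable R : realType.
Local Notation C := (Cplx R).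
Local Notation N := (@Normc.normc R).
Implicit Types (c x y w z : C) (A K : set C) (f g : C -> C).

Lemma modM x y : N (x * y) = N x * N y. Proof. exact: Normc.normcM. Qed.
Lemma modN x : N (- x) = N x. Proof. exact: normcN. Qed.
Lemma modD x y : N (x + y) <= N x + N y. Proof. exact: le_normcD. Qed.
Lemma modB x y : N (x - y) <= N x + N y.
Proof. by rewrite -(modN y) modD. Qed.
Lemma mod0 : N (0 : C) = 0. Proof. exact: Normc.normc0. Qed.
Lemma mod1 : N (1 : C) = 1. Proof. exact: Normc.normc1. Qed.
Lemma modV x : N x^-1 = (N x)^-1. Proof. exact: Normc.normcV. Qed.
Lemma mod_ge0 x : 0 <= N x. Proof. by case: x => a b; exact: sqrtr_ge0. Qed.
Lemma mod_eq0 x : N x = 0 -> x = 0. Proof. exact: Normc.eq0_normc. Qed.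
Lemma mod_gt0 x : (0 < N x) = (x != 0).
Proof.
rewrite lt0r mod_ge0 andbT; congr negb; apply/eqP/eqP => [/mod_eq0//|->].
exact: mod0.
Qed.
Lemma modBC x y : N (x - y) = N (y - x). Proof. by rewrite -modN opprB. Qed.
Lemma mod_tri y x w : N (x - w) <= N (x - y) + N (y - w).
Proof. by rewrite (_ : x - w = (x - y) + (y - w)) ?modD//; ring. Qed.
Lemma mod_subl x y : N x - N y <= N (x - y).
Proof. by rewrite lerBlDr -[leLHS](congr1 N (subrK y x)) modD. Qed.
Lemma modX x n : N (x ^+ n) = N x ^+ n.
Proof. by elim: n => [|n IH]; rewrite ?expr0 ?mod1// !exprS modM IH. Qed.
Lemma normrC x : `|x| = (N x)%:C%C. Proof. by []. Qed.
Lemma mod_Re x : `|complex.Re x| <= N x.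
Proof. by have := normc_ge_Re x; rewrite normrC lecR. Qed.
Lemma mod_Im x : `|complex.Im x| <= N x.
Proof.
case: x => a b /=; rewrite -sqrtr_sqr ler_sqrt ?lerDr ?sqr_ge0//.
by rewrite addr_ge0 ?sqr_ge0.
Qed.
Lemma mod_real (a : R) : N (a%:C%C : C) = `|a|.
Proof. by rewrite /= expr0n /= addr0 sqrtr_sqr. Qed.
Lemma mod_ReIm x : N x <= `|complex.Re x| + `|complex.Im x|.
Proof.
case: x => a b /=; rewrite -[leRHS]ger0_norm ?addr_ge0 // -sqrtr_sqr ler_sqrt ?sqr_ge0//.
rewrite sqrrD !real_normK ?num_real// -addrA lerD2l lerDr.
by rewrite mulrn_wge0 ?mulr_ge0.
Qed.

(** A positive element of [C] has zero imaginary part, so balls of complex radius are balls of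
    positive real radius. *)
Lemma nbhs_modP w A :
  nbhs w A <-> exists2 r : R, 0 < r & forall x, N (x - w) < r -> A x.
Proof.
split.
- move/nbhs_ballP => [e /= e0 h]; exists (complex.Re e).
    by move: e0; rewrite ltcE => /andP[].
  move=> x hx; apply: h; rewrite /ball /= normrC.
  move: e0; rewrite ltcE => /andP[/eqP e1 _].
  by rewrite ltcE /= e1 eqxx /= modBC.
- move=> [r r0 h]; apply/nbhs_ballP; exists (r%:C)%C => /=; first by rewrite ltcR.
  by move=> x; rewrite /ball /= normrC ltcR modBC; exact: h.
Qed.

Lemma cvg_modP f w l :
  f x @[x --> w] --> l <->
  forall e : R, 0 < e -> exists2 d : R, 0 < d & forall x, N (x - w) < d -> N (f x - l) < e.
Proof.
split.
- move=> h e e0; apply/(nbhs_modP w (fun x => N (f x - l) < e)).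
  by apply: (h [set y | N (y - l) < e]); apply/nbhs_modP; exists e.
- move=> h A /nbhs_modP[r r0 hA]; have [d d0 hd] := h r r0.
  by apply/nbhs_modP; exists d => // x hx; exact/hA/hd.
Qed.

Definition cts_at (f : C -> C) (w : C) : Prop := f x @[x --> w] --> f w.

Lemma cts_atP f w : cts_at f w <->
  forall e : R, 0 < e -> exists2 d : R, 0 < d & forall x, N (x - w) < d -> N (f x - f w) < e.
Proof. exact: cvg_modP. Qed.

Lemma cts_cst c w : cts_at (fun=> c) w.
Proof. exact: (@cvg_cst _ _ _ (nbhs w) (nbhs_filter w)). Qed.

Lemma cts_subr c w : cts_at (fun x => x - c) w.
Proof. by apply/cts_atP => e e0; exists e => // x; rewrite opprB addrA addrNK. Qed.

Lemma ctsD f g w : cts_at f w -> cts_at g w -> cts_at (fun x => f x + g x) w.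
Proof. exact: (@cvgD _ _ _ (nbhs w) (nbhs_filter w)). Qed.

Lemma ctsB f g w : cts_at f w -> cts_at g w -> cts_at (fun x => f x - g x) w.
Proof. exact: (@cvgB _ _ _ (nbhs w) (nbhs_filter w)). Qed.

Lemma ctsM f g w : cts_at f w -> cts_at g w -> cts_at (fun x => f x * g x) w.
Proof. exact: (@cvgM _ _ (nbhs w) (nbhs_filter w)). Qed.

Lemma ctsV f w : f w != 0 -> cts_at f w -> cts_at (fun x => (f x)^-1) w.
Proof. exact: (@cvgV _ _ (nbhs w) (nbhs_filter w)). Qed.

Lemma cts_comp f g w : cts_at f w -> cts_at g (f w) -> cts_at (fun x => g (f x)) w.
Proof. exact: continuous_comp. Qed.

Lemma within_modP K f : {within K, continuous f} <->
  forall w, K w -> forall e : R, 0 < e ->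
  exists2 d : R, 0 < d & forall x, K x -> N (x - w) < d -> N (f x - f w) < e.
Proof.
split.
- move/subspace_continuousP => h w Kw e e0.
  suff: nbhs w (fun x => K x -> N (f x - f w) < e).
    by move/nbhs_modP => [d d0 hd]; exists d => // x Kx xw; exact: hd.
  by apply: (h w Kw [set y | N (y - f w) < e]); apply/nbhs_modP; exists e.
- move=> h; apply/subspace_continuousP => w Kw A /nbhs_modP[r r0 hA].
  have [d d0 hd] := h w Kw r r0.
  by apply/nbhs_modP; exists d => // x hx Kx; exact/hA/hd.
Qed.

Lemma derivable_modP f w : derivable f w 1 <->
  exists l : C, forall e : R, 0 < e -> exists2 d : R, 0 < d &
    forall h, N h < d -> N (f (w + h) - f w - l * h) <= e * N h.
Proof.
rewrite /derivable; split.
- move=> /cvg_ex[l hl]; exists l => e e0.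
  have : nbhs (0 : C)^' [set h : C | N (h^-1 *: (f (h *: 1 + w) - f w) - l) < e].
    by apply: (hl [set y : C | N (y - l) < e]); apply/nbhs_modP; exists e.
  move/(nbhs_modP 0 _) => [d d0 hd]; exists d => // h hh.
  have [->|h0] := eqVneq h 0; first by rewrite addr0 subrr mulr0 subr0 mod0 mulr0.
  have /= := hd h; rewrite subr0 => /(_ hh h0) /ltW.
  rewrite -(@ler_pM2r _ (N h)) ?mod_gt0// -modM; congr (N _ <= _).
  by rewrite /GRing.scale /= mulr1 (addrC h) mulrBl mulrAC mulVf// mul1r.
- move=> [l hl]; apply/cvg_ex; exists l => A /nbhs_modP[r r0 hA].
  have r20 : 0 < r / 2 by lra.
  have [d d0 hd] := hl _ r20.
  apply/(nbhs_modP 0 _); exists d => //= h; rewrite subr0 => hh h0; apply: hA.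
  have hp : 0 < N h by rewrite mod_gt0.
  have -> : h^-1 *: (f (h *: 1 + w) - f w) - l = (f (w + h) - f w - l * h) * h^-1.
    by rewrite /GRing.scale /= mulr1 (addrC h) mulrBl mulfK // mulrC.
  rewrite modM modV ltr_pdivrMr// (le_lt_trans (hd h hh))// ltr_pM2r//; lra.
Qed.

End Modulus.

(** * Square roots of (w - a) / (w - b) *)

Section SquareRoot.
Local Open Scope ring_scope.
Variable R : realType.
Local Notation C := (Cplx R).
Local Notation N := (@Normc.normc R).
Local Notation Re := (@complex.Re R).
Implicit Types (a b c q x y w z : C) (A K : set C) (f s : C -> C).

Definition csqrt x : C := sqrtc x.

Lemma csqrt_sqr x : csqrt x ^+ 2 = x. Proof. exact: sqr_sqrtc. Qed.

Lemma Re_csqrt_ge0 x : 0 <= Re (csqrt x).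
Proof. by case: x => a b; exact: sqrtr_ge0. Qed.

Lemma ReD x y : Re (x + y) = Re x + Re y. Proof. by case: x y => ? ? []. Qed.
Lemma ReB x y : Re (x - y) = Re x - Re y. Proof. by case: x y => ? ? []. Qed.
Lemma Re_le_mod x : Re x <= N x. Proof. exact: le_trans (ler_norm _) (mod_Re x). Qed.

Lemma Re_csqrt_gt0 x : 0 < Re x -> 0 < Re (csqrt x).
Proof.
case: x => a b /= a0; rewrite sqrtr_gt0 divr_gt0// ltr_wpDl// sqrtr_ge0//.
Qed.

Lemma sub_sqr_mod x y : N (x ^+ 2 - y ^+ 2) = N (x - y) * N (x + y).
Proof. by rewrite -modM; congr (N _); ring. Qed.

(** Here |x - q| = |sqrt x - sqrt q| |sqrt x + sqrt q|, and the last factor is at least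
    [Re (csqrt q)]. *)
Lemma cts_csqrt q : 0 < Re q -> cts_at csqrt q.
Proof.
move=> /Re_csqrt_gt0 q0; apply/cts_atP => e e0.
exists (e * Re (csqrt q)); first exact: mulr_gt0.
move=> x; rewrite -{1}(csqrt_sqr x) -{1}(csqrt_sqr q) sub_sqr_mod => h.
rewrite -(ltr_pM2r q0); apply: le_lt_trans h; rewrite ler_wpM2l ?mod_ge0//.
by apply: le_trans (Re_le_mod _); rewrite ReD lerDr Re_csqrt_ge0.
Qed.

Variables (K : set C) (z : C) (d : R).
Hypothesis d0 : 0 < d.

Definition near_or_far w := K w \/ 10 * d <= N (w - z).
(** The sign condition selects, far from [z], the root close to 1; this is what lets two such roots
    be multiplied. *)
Definition sqrt_ratio a b := exists s : C -> C, forall w, near_or_far w ->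
  [/\ cts_at s w, s w ^+ 2 = (w - a) / (w - b) &
      10 * d <= N (w - z) -> 0 < Re (s w)].

Lemma ratioB1 a b w : w != b -> (w - a) / (w - b) - 1 = (b - a) / (w - b).
Proof.
move=> wb; have wb0 : w - b != 0 by rewrite subr_eq0.
by field.
Qed.

Lemma cts_ratio a b w : w != b -> cts_at (fun x => (x - a) / (x - b)) w.
Proof.
move=> wb; apply: ctsM; first exact: cts_subr.
by apply: ctsV; [rewrite subr_eq0|exact: cts_subr].
Qed.

(** The ratio lies within 1/2 of 1, hence in the right half-plane, where the principal root is
    continuous. *)
Lemma sqrt_ratio_near a b :
  (forall w, near_or_far w -> w != b /\ 2 * N (b - a) <= N (w - b)) -> sqrt_ratio a b.
Proof.
move=> h; exists (fun w => csqrt ((w - a) / (w - b))) => w /h[wb hw].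
have p : 0 < Re ((w - a) / (w - b)).
  have : `|Re ((w - a) / (w - b) - 1)| <= 1 / 2.
    apply: le_trans (mod_Re _) _; rewrite ratioB1// modM modV.
    by rewrite ler_pdivrMr ?mod_gt0 ?subr_eq0//; lra.
  by rewrite ReB /= ler_norml; lra.
split.
- by apply: (@cts_comp R (fun x => (x - a) / (x - b)) csqrt); [exact: cts_ratio|exact: cts_csqrt].
- exact: csqrt_sqr.
- by move=> _; exact: Re_csqrt_gt0.
Qed.

(** The deviation from 1 is |b - a| / |w - b|, with |b - a| at most [2 * d] and |w - b| at least
    9/10 of |w - z|. *)
Lemma far_ratio a b w : N (a - z) <= d -> N (b - z) <= d -> 10 * d <= N (w - z) ->
  w != b /\ N ((w - a) / (w - b) - 1) * (9 * N (w - z)) <= 20 * d.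
Proof.
have dp := d0; move=> ha hb hw.
have h1 : 9 * N (w - z) <= 10 * N (w - b).
  have := mod_tri b w z; lra.
have p : 0 < N (w - b) by lra.
have wb : w != b by move: p; rewrite mod_gt0 subr_eq0.
split=> //; rewrite ratioB1// modM modV.
have h2 : N (b - a) <= 2 * d.
  have := mod_tri z b a; rewrite (modBC z a); lra.
rewrite mulrAC ler_pdivrMr//.
have := mod_ge0 (b - a); nra.
Qed.

(** Factor q - 1 = (x - 1)(x + 1), where |x + 1| is at least 1. *)
Lemma near1_of_sqr x q : 0 < Re x -> x ^+ 2 = q -> N (x - 1) <= N (q - 1).
Proof.
move=> x0 <-; rewrite -{2}[1](expr1n _ 2) sub_sqr_mod.
rewrite ler_peMr ?mod_ge0//; apply: le_trans (Re_le_mod _).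
by rewrite ReD /= lerDr ltW.
Qed.

(** The ratios telescope, so the roots are multiplied. Far from [z] each root is within 2/9 of 1, so
    the product is within 40/81 of 1 and keeps a positive real part. *)
Lemma sqrt_ratio_trans a b c :
  N (a - z) <= d -> N (b - z) <= d -> N (c - z) <= d -> ~ K b ->
  sqrt_ratio a b -> sqrt_ratio b c -> sqrt_ratio a c.
Proof.
move=> ha hb hc Kb [s1 h1] [s2 h2]; exists (fun w => s1 w * s2 w) => w Dw.
have [c1 e1 r1] := h1 w Dw; have [c2 e2 r2] := h2 w Dw.
split; first exact: ctsM.
  rewrite exprMn e1 e2 mulrA divfK// subr_eq0.
  case: Dw => [Kw|hw]; first by apply/eqP => wb; apply: Kb; rewrite -wb.
  by have [] := far_ratio ha hb hw.
move=> hw; have [_ f1] := far_ratio ha hb hw; have [_ f2] := far_ratio hb hc hw.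
have n1 := near1_of_sqr (r1 hw) e1; have n2 := near1_of_sqr (r2 hw) e2.
have dp := d0.
have bd (t : R) : 0 <= t -> t * (9 * N (w - z)) <= 20 * d -> t <= 2 / 9.
  move=> t0 ht; have : t * (90 * d) <= 20 * d by apply: le_trans ht; rewrite ler_wpM2l//; lra.
  by rewrite mulrA ler_pM2r//; lra.
have s1b := le_trans n1 (bd _ (mod_ge0 _) f1).
have s2b := le_trans n2 (bd _ (mod_ge0 _) f2).
have : N (s1 w * s2 w - 1) <= 2 / 9 * (2 / 9) + 2 / 9 + 2 / 9.
  have -> : s1 w * s2 w - 1 = (s1 w - 1) * (s2 w - 1) + (s1 w - 1) + (s2 w - 1).
    by ring.
  apply: le_trans (modD _ _) _; apply: lerD => //.
  apply: le_trans (modD _ _) _; apply: lerD => //.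
  by rewrite modM; apply: ler_pM => //; exact: mod_ge0.
move/(le_trans (mod_Re _)); rewrite ReB /= ler_norml; lra.
Qed.

End SquareRoot.

(** * Chains of square roots through the complement of [K] *)

Section Chains.
Local Open Scope ring_scope.
Variable R : realType.
Local Notation C := (Cplx R).
Local Notation N := (@Normc.normc R).
Local Notation Re := (@complex.Re R).
Implicit Types (a b c q x y w z : C) (A K : set C) (f s : C -> C) (d e : R).

Lemma openC_mod K b : closed K -> ~ K b ->
  exists2 r : R, 0 < r & forall x, N (x - b) < r -> ~ K x.
Proof.
move=> cK Kb; have : nbhs b (~` K) by apply: open_nbhs_nbhs; split=> //; exact: closed_openC.
by move/nbhs_modP.
Qed.

(** With [r] at most a quarter of the margins of [b] to [K] and to the rim of the disk, the domain
    stays [3 * r] away from [c], more than twice |b - c|; so the principal root serves in both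
    directions. *)
Lemma sqrt_ratio_locally K z d b : closed K -> 0 < d -> ~ K b -> N (b - z) < d ->
  exists2 r : R, 0 < r & forall c, N (c - b) < r ->
  [/\ ~ K c, N (c - z) < d, sqrt_ratio K z d b c & sqrt_ratio K z d c b].
Proof.
move=> cK d0 Kb bz; have [r0 r00 hr] := openC_mod cK Kb.
have [r [rp r1 r2]] : exists r : R, [/\ 0 < r, 4 * r <= r0 & 4 * r <= d - N (b - z)].
  have [h|h] := leP r0 (d - N (b - z)).
    by exists (r0 / 4); split; lra.
  by exists ((d - N (b - z)) / 4); split; lra.
exists r => // c cb.
have dw w : near_or_far K z d w -> 4 * r <= N (w - b).
  case=> [Kw|wz].
    by rewrite leNgt; apply/negP => h; apply: (hr w) Kw; lra.
  have := mod_tri b w z; have := mod_ge0 (b - z); lra.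
have dwc w : near_or_far K z d w -> 3 * r <= N (w - c).
  by move/dw; have := mod_tri c w b; lra.
split.
- by apply: hr; lra.
- by have := mod_tri b c z; lra.
- apply: sqrt_ratio_near => // w Dw; have := dwc w Dw => h; split.
    by have : 0 < N (w - c) by [lra]; rewrite mod_gt0 subr_eq0.
  by lra.
- apply: sqrt_ratio_near => // w Dw; have := dw w Dw => h; split.
    by have : 0 < N (w - b) by [lra]; rewrite mod_gt0 subr_eq0.
  by rewrite modBC; lra.
Qed.

(** Otherwise the class of [a] would stay in the half disk; it would be open and closed in the
    complement of [K], hence all of it, although that complement is unbounded. *)
Lemma sqrt_ratio_leaves K z d a (B : R) : closed K -> (forall w, K w -> N w <= B) ->
  connected (~` K) -> 0 < d -> ~ K a -> N (a - z) < d ->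
  exists b, [/\ ~ K b, N (b - z) < d, d / 2 <= N (b - z) & sqrt_ratio K z d a b].
Proof.
move=> cK hB cn d0 Ka az; apply: contrapT => hno.
pose W := [set b | [/\ ~ K b, N (b - z) < d & sqrt_ratio K z d a b]].
have Wsmall b : W b -> N (b - z) < d / 2.
  move=> [h1 h2 h3]; rewrite ltNge; apply/negP => h4; apply: hno.
  by exists b.
have step b c : W b -> ~ K c -> N (c - z) < d -> sqrt_ratio K z d b c -> W c.
  move=> [h1 h2 h3] Kc hc s; split=> //.
  by apply: sqrt_ratio_trans h3 s => //; exact: ltW.
have Wa : W a.
  split=> //; have [r r0 h] := sqrt_ratio_locally cK d0 Ka az.
  by have [] := h a; rewrite ?subrr ?mod0.
have Wopen : open W.
  rewrite openE => b Wb; have [h1 h2 h3] := Wb.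
  have [r r0 h] := sqrt_ratio_locally cK d0 h1 h2.
  apply/nbhs_modP; exists r => // c /h [k1 k2 k3 _].
  exact: step k3.
have E : W = ~` K.
  apply: cn; first by exists a.
  - exists W => //; apply/seteqP; split=> [b Wb|b []//]; split=> //.
    by case: Wb.
  - exists (closure W); first exact: closed_closure.
    apply/seteqP; split=> [b Wb|b [Kb cb]].
      by split; [case: Wb|exact: subset_closure].
    (* A limit point of [W] is within 3/4 of [d] from [z], so the local step still applies to it. *)
    have bz : N (b - z) < d.
      have : nbhs b [set x | N (x - b) < d / 4] by apply/nbhs_modP; exists (d / 4) => //; lra.
      move/cb => [x [/Wsmall h1 /= h2]].
      have := mod_tri x b z; rewrite (modBC b x); lra.
    have [r r0 h] := sqrt_ratio_locally cK d0 Kb bz.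
    have : nbhs b [set x | N (x - b) < r] by apply/nbhs_modP; exists r.
    move/cb => [x [Wx /h[k1 k2 k3 k4]]].
    exact: step k4.
(* The point z + t has modulus at least |B| + d, beyond the bound on [K], and lies at distance at
   least [d] from [z]. *)
pose t : R := `|B| + N z + d.
have tz : N (z + (t%:C)%C - z) = t.
  rewrite (_ : z + _ - z = (t%:C)%C :> C); last by ring.
  by rewrite mod_real ger0_norm// addr_ge0 ?addr_ge0 ?mod_ge0// ltW.
have : W (z + (t%:C)%C).
  rewrite E => /hB; have := mod_subl (z + (t%:C)%C - z) (- z).
  rewrite tz modN opprK subrK /t; have := ler_norm B; lra.
by move/Wsmall; rewrite tz /t; have := mod_ge0 z; have := normr_ge0 B; lra.
Qed.

(** Caratheodory's criterion: a slope continuous at [w] has the derivative as its value there. *)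
Lemma derivable_slope f (g : C -> C) w (r : R) : 0 < r -> cts_at g w ->
  (forall x, N (x - w) < r -> f x - f w = g x * (x - w)) -> derivable f w 1.
Proof.
move=> r0 /cts_atP cg h; apply/derivable_modP; exists (g w) => e e0.
have [d d0 hd] := cg e e0.
exists (Num.min d r); first by rewrite lt_min d0.
move=> k; rewrite lt_min => /andP[kd kr].
have E : w + k - w = k by rewrite addrC addKr.
rewrite h ?E// -mulrBl modM ler_wpM2r ?mod_ge0// ltW// hd// E//.
Qed.

Lemma algA_cts K f : (forall w, K w -> cts_at f w) ->
  (forall w, interior K w -> derivable f w 1) -> algA K f.
Proof.
move=> h1 h2; split=> //; apply/within_modP => w /h1/cts_atP h e /h[d d0 hd].
by exists d => // x _; exact: hd.
Qed.

End Chains.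

(** * Functions concentrated near a boundary point *)

Section Cayley.
Local Open Scope ring_scope.
Variable R : realType.
Local Notation C := (Cplx R).
Local Notation N := (@Normc.normc R).
Local Notation Re := (@complex.Re R).
Implicit Types (a b c q x y w z : C) (A K : set C) (f s : C -> C) (d e : R).

Lemma mod_ratio x y : N (x / y) = N x / N y.
Proof. by rewrite modM modV. Qed.

Lemma mod_nat n : N (n%:R : C) = n%:R.
Proof. by rewrite -(rmorph_nat (real_complex R)) mod_real ger0_norm. Qed.

Definition cayley s w : C := (1 - s w) / (1 + s w).

(** Near [z], (s - 1)(s + 1) = (b - a) / (w - b) has modulus at least (3/8) / 11 = 3/88; if |1 + s|
    were below 1/88, then |s - 1| <= 3 would contradict this. At [z], |s|^2 = |z - a| / |z - b| <=
    1/4, so the transform is at least (1 - 1/2) / (1 + 1/2) = 1/3 in modulus. *)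
Lemma cayley_bounds K z d a b s : 0 < d -> K z -> ~ K a -> ~ K b ->
  N (a - z) < d / 8 -> N (b - z) < d -> d / 2 <= N (b - z) ->
  (forall w, near_or_far K z d w -> [/\ cts_at s w, s w ^+ 2 = (w - a) / (w - b) &
      10 * d <= N (w - z) -> 0 < Re (s w)]) ->
  [/\ 1 / 3 <= N (cayley s z), forall w, near_or_far K z d w -> 1 / 88 <= N (1 + s w) &
      forall w, 10 * d <= N (w - z) ->
        1 <= N (1 + s w) /\ N (cayley s w) * (9 * N (w - z)) <= 20 * d].
Proof.
move=> d0 Kz Ka Kb az bz bz2 hs.
have far w : 10 * d <= N (w - z) -> 1 <= N (1 + s w).
  move=> hw; have [_ _ /(_ hw) r] := hs w (or_intror hw).
  by apply: le_trans (Re_le_mod _); rewrite ReD /=; lra.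
have near w : near_or_far K z d w -> 1 / 88 <= N (1 + s w).
  move=> Dw; have [hw|hw] := leP (10 * d) (N (w - z)).
    by apply: le_trans (far w hw); lra.
  have [_ sq _] := hs w Dw.
  have wb : w != b.
    by case: Dw => [Kw|]; [apply/eqP => wb; apply: Kb; rewrite -wb|rewrite leNgt hw].
  have p : 0 < N (w - b) by rewrite mod_gt0 subr_eq0.
  have h1 : 3 / 8 * d <= N (b - a).
    by have := mod_tri a b z; lra.
  have h2 : N (w - b) <= 11 * d by have := mod_tri z w b; rewrite (modBC z b); lra.
  have : 3 / 88 <= N (s w ^+ 2 - 1).
    by rewrite sq ratioB1// mod_ratio ler_pdivlMr//; lra.
  rewrite (_ : _ - 1 = (s w - 1) * (1 + s w)); last by ring.
  rewrite modM => h3.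
  rewrite leNgt; apply/negP => h4.
  have h5 : N (s w - 1) <= 3.
    rewrite (_ : s w - 1 = (1 + s w) - 2%:R); last by ring.
    by apply: le_trans (modB _ _) _; rewrite mod_nat; lra.
  have := mod_ge0 (1 + s w); have := mod_ge0 (s w - 1); nra.
split=> //.
- have [_ sq _] := hs z (or_introl Kz).
  have zb : 0 < N (z - b) by rewrite modBC; lra.
  have : N (s z) ^+ 2 <= 1 / 4.
    by rewrite -modX sq mod_ratio ler_pdivrMr// (modBC z b) (modBC z a); lra.
  have := mod_ge0 (s z) => s0 s2.
  have s1 : N (s z) <= 1 / 2 by nra.
  have p : 0 < N (1 + s z) by have := near z (or_introl Kz); lra.
  rewrite /cayley mod_ratio ler_pdivlMr//.
  have := modD 1 (s z); have := mod_subl 1 (s z); rewrite mod1; lra.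
- move=> w hw; split; first exact: far.
  have [_ sq /(_ hw) r] := hs w (or_intror hw).
  have [_ h] := @far_ratio R z d d0 a b w ltac:(lra) ltac:(lra) hw.
  apply: le_trans h; rewrite ler_wpM2r ?mulr_ge0 ?mod_ge0//.
  apply: le_trans (near1_of_sqr r sq).
  rewrite /cayley mod_ratio (modBC 1) ler_piMr ?mod_ge0// invf_le1 ?far//.
  by apply: lt_le_trans (far w hw).
Qed.

Lemma ratio_sub a b x y : x != b -> y != b ->
  (x - a) / (x - b) - (y - a) / (y - b) = (a - b) / ((x - b) * (y - b)) * (x - y).
Proof.
move=> xb yb; have xb0 : x - b != 0 by rewrite subr_eq0.
have yb0 : y - b != 0 by rewrite subr_eq0.
by field; rewrite xb0 yb0.
Qed.

(* The slope factor is continuous in x, whence differentiability. *)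
Lemma cayley_sub a b s x y : x != b -> y != b ->
  s x ^+ 2 = (x - a) / (x - b) -> s y ^+ 2 = (y - a) / (y - b) ->
  s x + s y != 0 -> 1 + s x != 0 -> 1 + s y != 0 ->
  cayley s x - cayley s y =
  - 2%:R * ((a - b) / ((x - b) * (y - b))) / (s x + s y) / ((1 + s x) * (1 + s y)) * (x - y).
Proof.
move=> xb yb sx sy nz nx ny; rewrite /cayley.
have E : s x - s y = (a - b) / ((x - b) * (y - b)) * (x - y) / (s x + s y).
  by rewrite -ratio_sub// -sx -sy subr_sqr mulfK.
rewrite -(mulrA (- 2%:R)) -(mulrA (- 2%:R)) -(mulrA (- 2%:R)).
have -> : (a - b) / ((x - b) * (y - b)) / (s x + s y) / ((1 + s x) * (1 + s y)) * (x - y)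
   = (s x - s y) / ((1 + s x) * (1 + s y)).
  rewrite E; move: ((a - b) / _) (((1 + s x) * _)^-1) ((s x + s y)^-1) => t i j; ring.
by field; rewrite nx ny.
Qed.

End Cayley.

Section BoundaryFunctions.
Local Open Scope ring_scope.
Variable R : realType.
Local Notation C := (Cplx R).
Local Notation N := (@Normc.normc R).
Local Notation Re := (@complex.Re R).
Implicit Types (a b c q x y w z : C) (A K : set C) (f s : C -> C) (d e : R).

(** In the slope of [cayley_sub], [100 * d <= e ^+ 2] bounds |a - b| / (|x - b| |y - b|) by 1/6,
    while real parts of the roots at least 3/4 keep the other denominators at least 1. The resulting
    1/3 is absorbed when the transform is normalised at [z]. *)
Lemma cayley_lipschitz z d e a b s x y : 0 < d -> 100 * d <= e -> 100 * d <= e ^+ 2 ->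
  N (a - z) < d -> N (b - z) < d -> e <= N (x - z) -> e <= N (y - z) ->
  0 < Re (s x) -> 0 < Re (s y) ->
  s x ^+ 2 = (x - a) / (x - b) -> s y ^+ 2 = (y - a) / (y - b) ->
  N (cayley s x - cayley s y) <= 1 / 3 * N (x - y).
Proof.
move=> d0 d1 d2 az bz ex ey rx ry sx sy.
have e0 : 0 < e by lra.
have far_b w : e <= N (w - z) -> 99 * e <= 100 * N (w - b) /\ w != b.
  move=> ew; have h : 99 * e <= 100 * N (w - b) by have := mod_tri b w z; lra.
  by split=> //; rewrite -subr_eq0 -mod_gt0; lra.
have [xb xb'] := far_b x ex; have [yb yb'] := far_b y ey.
have near1 w : e <= N (w - z) -> 0 < Re (s w) -> s w ^+ 2 = (w - a) / (w - b) ->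
    3 / 4 <= Re (s w).
  move=> ew r E; have h := near1_of_sqr r E.
  have [_ h2] := @far_ratio R z d d0 a b w ltac:(lra) ltac:(lra) ltac:(lra).
  have h3 : N ((w - a) / (w - b) - 1) * (900 * d) <= 20 * d.
    by apply: le_trans h2; rewrite ler_wpM2l ?mod_ge0//; lra.
  move: h3; rewrite mulrA ler_pM2r// => h3.
  have : `|Re (s w - 1)| <= 1 / 4 by apply: le_trans (mod_Re _) _; lra.
  by rewrite ReB /= ler_norml; lra.
have ss : 1 <= N (s x + s y).
  apply: le_trans (Re_le_mod _); rewrite ReD.
  by have := near1 x ex rx sx; have := near1 y ey ry sy; lra.
have s1 w : 0 < Re (s w) -> 1 <= N (1 + s w).
  by move=> r; apply: le_trans (Re_le_mod _); rewrite ReD /=; lra.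
have x1 := s1 x rx; have y1 := s1 y ry.
have k : N ((a - b) / ((x - b) * (y - b))) <= 1 / 6.
  have p : 99 * e * (99 * e) <= 100 * N (x - b) * (100 * N (y - b)).
    by apply: ler_pM => //; lra.
  have p0 : 0 < N ((x - b) * (y - b)) by rewrite modM mulr_gt0; lra.
  rewrite mod_ratio ler_pdivrMr// modM.
  have := mod_tri z a b; rewrite (modBC z b); move: d2 p; rewrite expr2.
  move: (N (x - b)) (N (y - b)) => X Y.
  lra.
have nz w : 1 <= N w -> w != 0 by move=> h; rewrite -mod_gt0; lra.
rewrite (@cayley_sub R a b) ?nz// modM ler_wpM2r ?mod_ge0//.
have D1 : 1 <= N ((1 + s x) * (1 + s y)) by rewrite modM; exact: mulr_ege1.
rewrite mod_ratio ler_pdivrMr; last by lra.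
rewrite mod_ratio ler_pdivrMr; last by lra.
rewrite [leLHS]modM modN mod_nat.
apply: (@le_trans _ _ (1 / 3)); first lra.
have := mulr_ege1 D1 ss; lra.
Qed.

(* [|1 + s| >= 1/88] bounds the Cayley transform by 177, and its value at [z] is at least 1/3. *)
Lemma boundary_functions K z (B : R) : closed K -> (forall w, K w -> N w <= B) ->
  connected (~` K) -> K z -> ~ interior K z -> exists2 M : R, 0 <= M & forall e, 0 < e ->
  exists f, [/\ algA K f, f z = 1, forall w, K w -> N (f w) <= M,
    forall w, K w -> e <= N (w - z) -> N (f w) <= 1 / 8 &
    forall x y, K x -> K y -> e <= N (x - z) -> e <= N (y - z) ->
      N (f x - f y) <= N (x - y)].
Proof.
move=> cK hB cn Kz iz; exists (3 * 177) => [|e e0]; first by rewrite mulr_ge0.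
(* The bound by [e] places points at distance [e] in the far region; the bound by [e ^+ 2] serves
   the Lipschitz estimate. *)
have [d [d0 d1 d2]] : exists d : R, [/\ 0 < d, 100 * d <= e & 100 * d <= e ^+ 2].
  have [h|h] := leP e (e ^+ 2); first by exists (e / 100); split; lra.
  by exists (e ^+ 2 / 100); split; first have := exprn_gt0 2 e0; lra.
have [a [Ka az]] : exists a, ~ K a /\ N (a - z) < d / 8.
  apply: contrapT => h; apply/iz/nbhs_modP; exists (d / 8); first lra.
  by move=> x xz; apply: contrapT => Kx; apply: h; exists x.
have az' : N (a - z) < d by lra.
have [b [Kb bz bz2 [s hs]]] : exists b, [/\ ~ K b, N (b - z) < d, d / 2 <= N (b - z) &
    sqrt_ratio K z d a b].
  exact: sqrt_ratio_leaves cK hB cn d0 Ka az'.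
have [uz near far] := cayley_bounds d0 Kz Ka Kb az bz bz2 hs.
set u := cayley s in uz far.
pose f w := u w / u z.
have uz0 : u z != 0 by rewrite -mod_gt0; lra.
have fu w : N (f w) <= 3 * N (u w).
  rewrite mod_ratio ler_pdivrMr ?mod_gt0//.
  by have := mod_ge0 (u w); nra.
have nz w : near_or_far K z d w -> 1 + s w != 0.
  by move=> /near h; rewrite -mod_gt0; lra.
have Kneq w c : K w -> ~ K c -> w != c.
  by move=> Kw Kc; apply/eqP => wc; apply: Kc; rewrite -wc.
have s0 w : K w -> s w != 0.
  move=> Kw; have [_ E _] := hs w (or_introl Kw).
  apply/eqP => sw; move: E; rewrite sw expr0n /= => /esym/eqP.
  by rewrite mulf_eq0 invr_eq0 !subr_eq0 (negPf (Kneq _ _ Kw Ka)) (negPf (Kneq _ _ Kw Kb)).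
have cs w : K w -> cts_at s w by move=> Kw; have [] := hs w (or_introl Kw).
exists f; split.
- apply: algA_cts => w.
    move=> Kw; have cm : cts_at (fun x => 1 - s x) w by apply: ctsB; [exact: cts_cst|exact: cs].
    have cp : cts_at (fun x => 1 + s x) w by apply: ctsD; [exact: cts_cst|exact: cs].
    have ci : cts_at (fun x => (1 + s x)^-1) w by apply: ctsV => //; apply: nz; left.
    have cu : cts_at u w by exact: (@ctsM R (fun x => 1 - s x) (fun x => (1 + s x)^-1) w cm ci).
    by apply: (@ctsM R u (fun=> (u z)^-1)); [exact: cu|exact: cts_cst].
  move=> iw; have Kw := interior_subset iw.
  move/nbhs_modP : iw => [r r0 hr].
  pose g x := - 2%:R * ((a - b) / ((x - b) * (w - b))) / (s x + s w)
    / ((1 + s x) * (1 + s w)) / u z.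
  have wb : w - b != 0 by rewrite subr_eq0 Kneq.
  have nw : 1 + s w != 0 by apply: nz; left.
  pose k x := (a - b) / ((x - b) * (w - b)).
  have ck : cts_at k w.
    apply: (@ctsM R (fun=> a - b) (fun x => ((x - b) * (w - b))^-1)); first exact: cts_cst.
    apply: ctsV; first by rewrite mulf_neq0.
    by apply: (@ctsM R (fun x => x - b) (fun=> w - b)); [exact: cts_subr|exact: cts_cst].
  have c1 : cts_at (fun x => (s x + s w)^-1) w.
    apply: ctsV; first by rewrite -mulr2n mulrn_eq0 /= s0.
    by apply: ctsD; [exact: cs|exact: cts_cst].
  have c2 : cts_at (fun x => ((1 + s x) * (1 + s w))^-1) w.
    apply: ctsV; first by rewrite mulf_neq0.
    apply: (@ctsM R (fun x => 1 + s x) (fun=> 1 + s w)); last exact: cts_cst.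
    by apply: ctsD; [exact: cts_cst|exact: cs].
  have cg : cts_at g w.
    apply: (@ctsM R (fun x => - 2%:R * k x / (s x + s w) / ((1 + s x) * (1 + s w)))
      (fun=> (u z)^-1)); last exact: cts_cst.
    apply: (@ctsM R (fun x => - 2%:R * k x / (s x + s w)) _ w _ c2).
    apply: (@ctsM R (fun x => - 2%:R * k x) _ w _ c1).
    by apply: (@ctsM R (fun=> - 2%:R) k w _ ck); exact: cts_cst.
  (* The slope formula divides by [s x + s w], which is nonzero as soon as |s x - s w| < |s w|. *)
  have [r1 r10 hr1] : exists2 r1 : R, 0 < r1 & forall x, N (x - w) < r1 -> s x + s w != 0.
    have sw : 0 < N (s w) by rewrite mod_gt0 s0.
    have [r1 r10 h] := (cts_atP _ _).1 (cs w Kw) _ sw.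
    exists r1 => // x /h hx; rewrite -mod_gt0 addrC.
    have := modB (s w + s w) (s w + s x).
    have -> : s w + s w - (s w + s x) = - (s x - s w) by ring.
    rewrite modN (_ : s w + s w = 2%:R * s w); last by ring.
    have := mod_subl (2%:R * s w) (s w - s x).
    rewrite (_ : 2%:R * s w - (s w - s x) = s w + s x); last by ring.
    by rewrite modM mod_nat (modBC (s w)); lra.
  have m0 : 0 < Num.min r r1 by rewrite lt_min r0.
  apply: (derivable_slope m0 cg) => x; rewrite lt_min => /andP[/hr Kx /hr1 sx].
  rewrite /f -mulrBl /u.
  rewrite (@cayley_sub R a b) ?(Kneq x b Kx Kb) ?(Kneq w b Kw Kb) ?nw//; first by
    rewrite /g /u; ring.
  - by have [] := hs x (or_introl Kx).
  - by have [] := hs w (or_introl Kw).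
  - by apply: nz; left.
- exact: divff.
- move=> w Kw; apply: le_trans (fu w) _.
  rewrite ler_pM2l//.
  have h := near w (or_introl Kw).
  rewrite /u /cayley mod_ratio ler_pdivrMr; last by lra.
  rewrite (_ : 1 - s w = 2%:R - (1 + s w)); last by ring.
  by apply: le_trans (modB _ _) _; rewrite mod_nat; lra.
- move=> w Kw ew; apply: le_trans (fu w) _.
  have [_ h] := far w ltac:(lra).
  suff : N (u w) <= 1 / 24 by lra.
  have ed : N (u w) * (9 * e) <= 20 * d.
    by apply: le_trans h; rewrite ler_wpM2l ?mod_ge0//; lra.
  have := mod_ge0 (u w) => u0.
  rewrite leNgt; apply/negP => hu; have : 1 / 24 * (9 * e) < N (u w) * (9 * e).
    by rewrite ltr_pM2r//; lra.
  lra.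
- move=> x y Kx Ky ex ey.
  have [x1 _] := far x ltac:(lra); have [y1 _] := far y ltac:(lra).
  have [_ sx rx] := hs x (or_introl Kx); have [_ sy ry] := hs y (or_introl Ky).
  have rx' := rx ltac:(lra); have ry' := ry ltac:(lra).
  rewrite /f -mulrBl mod_ratio ler_pdivrMr; last by lra.
  apply: le_trans (cayley_lipschitz d0 d1 d2 az' bz ex ey rx' ry' sx sy) _.
  by rewrite mulrC ler_wpM2l ?mod_ge0.
Qed.

End BoundaryFunctions.

(** * Limits with geometric error, and closure properties of [algA K] *)

Section Limits.
Local Open Scope ring_scope.
Variable R : realType.
Local Notation C := (Cplx R).
Local Notation N := (@Normc.normc R).
Local Notation Re := (@complex.Re R).
Local Notation Im := (@complex.Im R).
Implicit Types (a b c x y w z : C) (A K : set C) (f s : C -> C) (d e l : R).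

Lemma geometric_small l D e : 0 < l < 1 -> 0 < e ->
  exists n0, forall n, (n0 <= n)%N -> D * l ^+ n < e.
Proof.
move=> /andP[l0 l1] e0.
have h : D * l ^+ n @[n --> \oo] --> (0 : R).
  rewrite -(mulr0 D); apply: cvgMr; apply: cvg_expr; by rewrite gtr0_norm.
have : \forall n \near \oo, D * l ^+ n < e by apply: (cvgr_lt 0 h).
by move=> [n0 _ hn]; exists n0 => n ?; exact: hn.
Qed.

Lemma le_of_geometric l D (a b : R) : 0 < l < 1 ->
  (exists n0, forall n, (n0 <= n)%N -> a <= b + D * l ^+ n) -> a <= b.
Proof.
move=> hl [n0 h]; apply/ler_addgt0Pr => e /(geometric_small D hl)[n1 h1].
have := h (maxn n0 n1) (leq_maxl _ _); have := h1 (maxn n0 n1) (leq_maxr _ _); lra.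
Qed.

(** The step bounds from index [n] on sum to [D * l ^+ n], so the intervals of that radius about
    [x n] are nested; the supremum of their left ends is the limit. *)
Lemma geometric_limit_real l D (x : nat -> R) : 0 < l < 1 ->
  (forall n, `|x n.+1 - x n| <= D * ((1 - l) * l ^+ n)) ->
  exists L, forall n, `|L - x n| <= D * l ^+ n.
Proof.
move=> /andP[l0 l1] h.
pose lo n := x n - D * l ^+ n; pose hi n := x n + D * l ^+ n.
have step n : lo n <= lo n.+1 /\ hi n.+1 <= hi n.
  have := h n; rewrite ler_norml /lo /hi exprS => /andP[]; split; lra.
have D0 : 0 <= D.
  have := le_trans (normr_ge0 _) (h 0); rewrite expr0 mulr1 pmulr_lge0//; lra.
have mlo m n : (m <= n)%N -> lo m <= lo n.
  move=> /subnK <-; elim: (n - m)%N => // k IH.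
  by apply: le_trans IH _; rewrite addSn; exact: (step _).1.
have mhi m n : (m <= n)%N -> hi n <= hi m.
  move=> /subnK <-; elim: (n - m)%N => // k IH.
  by apply: le_trans _ IH; rewrite addSn; exact: (step _).2.
have lohi n : lo n <= hi n.
  by rewrite /lo /hi; have := mulr_ge0 D0 (exprn_ge0 n (ltW l0)); lra.
have cross m n : lo m <= hi n.
  have [mn|nm] := leqP m n; first exact: le_trans (mlo _ _ mn) (lohi n).
  exact: le_trans (lohi m) (mhi _ _ (ltnW nm)).
exists (sup (range lo)) => n.
have h1 : lo n <= sup (range lo).
  by apply: ub_le_sup; [exists (hi 0) => _ [m _ <-]|exists n].
have h2 : sup (range lo) <= hi n.
  by apply: ge_sup; [exists (lo 0), 0|move=> _ [m _ <-]].
by move: h1 h2; rewrite /lo /hi ler_norml; lra.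
Qed.

(** Real and imaginary parts converge separately and their errors add, hence the factor 2. *)
Lemma geometric_limit l D (x : nat -> C) : 0 < l < 1 ->
  (forall n, N (x n.+1 - x n) <= D * ((1 - l) * l ^+ n)) ->
  exists L : C, forall n, N (L - x n) <= 2 * D * l ^+ n.
Proof.
move=> hl h.
have [L1 h1] : exists L, forall n, `|L - Re (x n)| <= D * l ^+ n.
  by apply: geometric_limit_real => // n; rewrite -ReB; apply: le_trans (mod_Re _) _.
have [L2 h2] : exists L, forall n, `|L - Im (x n)| <= D * l ^+ n.
  apply: geometric_limit_real => // n; have := le_trans (mod_Im _) (h n).
  by case: (x n.+1) (x n) => ? ? [].
exists (Complex L1 L2) => n; apply: le_trans (mod_ReIm _) _.
by have := h1 n; have := h2 n; case: (x n) => a b /=; lra.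
Qed.

Lemma algA_cst K c : algA K (fun=> c).
Proof. by apply: algA_cts => w _; [exact: cts_cst|exact: derivable_cst]. Qed.

Lemma algA_D K f g : algA K f -> algA K g -> algA K (fun x => f x + g x).
Proof.
move=> [cf df] [cg dg]; split; last by move=> w Kw; apply: derivableD; [exact: df|exact: dg].
apply/within_modP => w Kw e e0.
have e2 : 0 < e / 2 by lra.
have [d1 d10 h1] := (within_modP _ _).1 cf w Kw _ e2.
have [d2 d20 h2] := (within_modP _ _).1 cg w Kw _ e2.
exists (Num.min d1 d2); first by rewrite lt_min d10.
move=> x Kx; rewrite lt_min => /andP[/(h1 x Kx) k1 /(h2 x Kx) k2].
rewrite (_ : _ - _ = (f x - f w) + (g x - g w)); last by ring.
by apply: le_lt_trans (modD _ _) _; lra.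
Qed.

Lemma algA_M K f g : algA K f -> algA K g -> algA K (fun x => f x * g x).
Proof.
move=> [cf df] [cg dg]; split; last by move=> w Kw; apply: derivableM; [exact: df|exact: dg].
move=> w; exact: (cvgM (cf w) (cg w)).
Qed.

End Limits.

(** * The peaking series *)

Section Peak.
Local Open Scope ring_scope.
Variable R : realType.
Local Notation C := (Cplx R).
Local Notation N := (@Normc.normc R).
Local Notation Re := (@complex.Re R).
Implicit Types (a b c x y w z : C) (f g : C -> C) (d e : R).

Variables (K : set C) (z : C) (M l : R).
Hypotheses (Kz : K z) (l01 : 0 < l < 1) (lM : (1 - l) * M <= 1 / 2).

Definition concentrated e f := [/\ algA K f, f z = 1, forall w, K w -> N (f w) <= M,
    forall w, K w -> e <= N (w - z) -> N (f w) <= 1 / 8 &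
    forall x y, K x -> K y -> e <= N (x - z) -> e <= N (y - z) ->
      N (f x - f y) <= N (x - y)].

Hypothesis exF : forall e, 0 < e -> exists f, concentrated e f.

(* [r n] is chosen after the partial sum [G n], from its continuity at [z]; hence a recursion on
   the functions [G n] themselves. *)
Lemma gliding_hump : exists (G F : nat -> C -> C) (r : nat -> R),
  [/\ G 0%N = (fun=> 0),
      forall n w, G n.+1 w = G n w + (((1 - l) * l ^+ n)%:C)%C * F n w,
      forall n, concentrated (r n) (F n),
      forall n, 0 < r n /\ r n <= l ^+ n &
      forall n, algA K (G n) -> forall w, K w -> N (w - z) < r n ->
        N (G n w) <= N (G n z) + l ^+ n / 8].
Proof.
have /andP[l0 l1] := l01.
have [Fc hF] : exists Fc : R -> C -> C, forall e, 0 < e -> concentrated e (Fc e).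
  suff : forall e, exists f, 0 < e -> concentrated e f by move=> /choice[X hX]; exists X.
  move=> e; have [e0|e0] := ltP 0 e; last by exists (fun=> 0).
  by have [f hf] := exF e0; exists f.
have [Ec hE] : exists Ec : (C -> C) * nat -> R, forall p,
    [/\ 0 < Ec p, Ec p <= l ^+ p.2 & algA K p.1 -> forall w, K w -> N (w - z) < Ec p ->
        N (p.1 w) <= N (p.1 z) + l ^+ p.2 / 8].
  suff : forall p : (C -> C) * nat, exists r : R, [/\ 0 < r, r <= l ^+ p.2 & algA K p.1 ->
      forall w, K w -> N (w - z) < r -> N (p.1 w) <= N (p.1 z) + l ^+ p.2 / 8].
    by move=> /choice[X hX]; exists X.
  move=> [G n] /=; have ln : 0 < l ^+ n by exact: exprn_gt0.
  (* If [G] is not in [algA K], the last clause is void and [l ^+ n] serves as default radius. *)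
  have [[cG dG]|nA] := pselect (algA K G); last by exists (l ^+ n).
  have ln8 : 0 < l ^+ n / 8 by lra.
  have [d d0 hd] := (within_modP _ _).1 cG z Kz _ ln8.
  exists (Num.min d (l ^+ n)); split; [by rewrite lt_min d0|by rewrite ge_min lexx orbT|].
  move=> _ w Kw; rewrite lt_min => /andP[/(hd w Kw) h _].
  by have := mod_subl (G w) (G z); lra.
pose G := fix G n : C -> C := if n is m.+1 then
  (fun w => G m w + (((1 - l) * l ^+ m)%:C)%C * Fc (Ec (G m, m)) w) else (fun=> 0).
exists G, (fun n => Fc (Ec (G n, n))), (fun n => Ec (G n, n)); split=> //.
- by move=> n; apply: hF; have [] := hE (G n, n).
- by move=> n; have [] := hE (G n, n).
- by move=> n; have [_ _] := hE (G n, n).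
Qed.

Hypothesis iz : ~ interior K z.

(** The series of the [F n] with weights (1 - l) l^n converges uniformly on [K] to a function equal
    to 1 at [z]. As the radii tend to 0, only finitely many terms can be large at a given [w] other
    than [z], and when one is added the partial sum at [w] is still controlled by its value at
    [z]. *)
Lemma peak_of_concentrated : 0 <= M -> peak_point K z.
Proof.
move=> M0; have /andP[l0 l1] := l01.
have [G [F [r [G0 GS hF hr hG]]]] := gliding_hump.
have lp n : 0 < l ^+ n by exact: exprn_gt0.
have ladd n k : l ^+ (n + k) <= l ^+ k.
  by rewrite exprD ler_piMl ?(ltW (lp k))// exprn_ile1 ?(ltW l0) ?(ltW l1).
have cp n : 0 < (1 - l) * l ^+ n by rewrite mulr_gt0// subr_gt0.
have Nc n : N (((1 - l) * l ^+ n)%:C)%C = (1 - l) * l ^+ n.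
  by rewrite mod_real gtr0_norm.
have aG n : algA K (G n).
  elim: n => [|n IH]; first by rewrite G0; exact: algA_cst.
  have -> : G n.+1 = (fun w => G n w + (((1 - l) * l ^+ n)%:C)%C * F n w).
    by apply/funext => w; exact: GS.
  have [aF _ _ _ _] := hF n; exact: (algA_D IH (algA_M (algA_cst _ _) aF)).
have Gz n : G n z = ((1 - l ^+ n)%:C)%C.
  elim: n => [|n IH]; first by rewrite G0 expr0 subrr.
  have [_ Fz _ _ _] := hF n; rewrite GS IH Fz mulr1 -rmorphD /=; congr (_%:C)%C.
  by rewrite exprS; ring.
have NGz n : N (G n z) = 1 - l ^+ n.
  by rewrite Gz mod_real ger0_norm// subr_ge0 exprn_ile1 ?ltW.
have dG n w : K w -> N (G n.+1 w - G n w) <= M * ((1 - l) * l ^+ n).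
  move=> Kw; rewrite GS addrC addKr modM Nc mulrC ler_wpM2r ?(ltW (cp n))//.
  by have [_ _ h _ _] := hF n; exact: h.
have [g hg] : exists g : C -> C, forall w, K w -> forall n, N (g w - G n w) <= 2 * M * l ^+ n.
  suff : forall w, exists L : C, K w -> forall n, N (L - G n w) <= 2 * M * l ^+ n.
    by move=> /choice[X hX]; exists X.
  move=> w; have [Kw|nK] := pselect (K w); last by exists 0.
  by have [L hL] := geometric_limit l01 (fun n => dG n w Kw); exists L.
have gz : g z = 1.
  apply/eqP; rewrite -subr_eq0 -[_ == 0]negbK -mod_gt0 -leNgt.
  apply: (le_of_geometric l01 (D := 2 * M + 1)); exists 0%N => n _.
  have := mod_tri (G n z) (g z) 1; have := hg z Kz n; rewrite Gz.
  have -> : ((1 - l ^+ n)%:C)%C - 1 = - ((l ^+ n)%:C)%C :> C.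
    by rewrite rmorphB /= addrAC subrr sub0r.
  by rewrite modN mod_real gtr0_norm//; lra.
have far w : 0 < N (w - z) -> exists n0, forall n, (n0 <= n)%N -> r n <= N (w - z).
  move=> /(geometric_small 1 l01)[n0 h]; exists n0 => n /h; rewrite mul1r => h1.
  by have [_ h2] := hr n; lra.
have lt1 w : K w -> w != z -> N (g w) < 1.
  move=> Kw wz; have p : 0 < N (w - z) by rewrite mod_gt0 subr_eq0.
  have [n0 hn0] := far w p.
  have NG n : N (G n.+1 w) <= N (G n w) + (1 - l) * l ^+ n * N (F n w).
    by rewrite GS; apply: le_trans (modD _ _) _; rewrite modM Nc.
  (* The gain (1 - l) l^n / 8 is exactly the drop from [l ^+ n / 8] to [l ^+ n.+1 / 8]. *)
  have fstep n : r n <= N (w - z) -> N (G n.+1 w) + l ^+ n.+1 / 8 <= N (G n w) + l ^+ n / 8.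
    move=> h; have [_ _ _ /(_ w Kw h) h1 _] := hF n.
    have := NG n; have : (1 - l) * l ^+ n * N (F n w) <= (1 - l) * l ^+ n * (1 / 8).
      by rewrite ler_pM2l.
    by rewrite exprS; lra.
  (* If [w] is within [r n], the partial sum is at most 1 - l^n + l^n / 8 and, by [lM], the next
     term adds at most l^n / 2; together with [l ^+ n.+1 / 8] this stays below 1 - l^n / 4. *)
  have lt n : N (G n w) + l ^+ n / 8 < 1.
    elim: n => [|n IH]; first by rewrite G0 mod0 expr0; lra.
    have [h|h] := leP (r n) (N (w - z)); first by apply: le_lt_trans (fstep n h) IH.
    have := hG n (aG n) w Kw h; rewrite NGz => h1.
    have := dG n w Kw; have := mod_subl (G n.+1 w) (G n w).
    have : (1 - l) * M * l ^+ n <= 1 / 2 * l ^+ n by rewrite ler_pM2r.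
    have : l * l ^+ n < l ^+ n by rewrite gtr_pMl.
    by have := lp n; rewrite exprS; lra.
  have mono k : N (G (n0 + k)%N w) + l ^+ (n0 + k) / 8 <= N (G n0 w) + l ^+ n0 / 8.
    elim: k => [|k IH]; first by rewrite addn0.
    by apply: le_trans IH; rewrite addnS; apply: fstep; apply: hn0; rewrite leq_addr.
  (* Past [n0] the controlled quantity cannot rise, so the strict bound at the fixed index [n0]
     survives the limit. *)
  apply: le_lt_trans (lt n0).
  apply: (le_of_geometric l01 (D := 2 * M)); exists n0 => n /subnKC nE.
  have := mono (n - n0)%N; rewrite nE.
  have := mod_subl (g w) (G n w); have := hg w Kw n; have := lp n; lra.
split=> //; exists g; last first.
  by split=> // w [Kw /eqP wz]; rewrite normrC ltcR lt1.
split.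
- apply/within_modP => w Kw e e0.
  have e3 : 0 < e / 3 by lra.
  have [n0 /(_ n0 (leqnn _)) h] := geometric_small (2 * M) l01 e3.
  have [cG _] := aG n0; have [d d0 hd] := (within_modP _ _).1 cG w Kw _ e3.
  exists d => // x Kx /(hd x Kx) k.
  have := mod_tri (G n0 x) (g x) (g w); have := mod_tri (G n0 w) (G n0 x) (g w).
  by have := hg x Kx n0; have := hg w Kw n0; rewrite (modBC (g w)); lra.
(* Term-by-term differentiation: from [n0] on the [F n] are 1-Lipschitz around [w], so the
   difference quotients of the partial sums converge geometrically, uniformly in [h]. *)
- move=> w iw; have Kw := interior_subset iw.
  have wz : 0 < N (w - z).
    by rewrite mod_gt0 subr_eq0; apply/eqP => wz; apply: iz; rewrite -wz.
  have p2 : 0 < N (w - z) / 2 by lra.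
  have [n0 hn0] : exists n0, forall n, (n0 <= n)%N -> r n <= N (w - z) / 2.
    have [n0 h] := geometric_small 1 l01 p2; exists n0 => n /h; rewrite mul1r => h1.
    by have [_ h2] := hr n; lra.
  move/nbhs_modP : iw => [r0 r00 hr0].
  have [r1 [r10 r1a r1b]] : exists r1 : R, [/\ 0 < r1, r1 <= r0 & r1 <= N (w - z) / 2].
    by exists (Num.min r0 (N (w - z) / 2)); rewrite lt_min r00 p2 !ge_min !lexx orbT.
  have lip n h : (n0 <= n)%N -> N h < r1 ->
      N ((G n.+1 (w + h) - G n.+1 w) - (G n (w + h) - G n w)) <= (1 - l) * l ^+ n * N h.
    move=> nn hh; have E : w + h - w = h by rewrite addrC addKr.
    have Kwh : K (w + h) by apply: hr0; rewrite E; lra.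
    have [_ _ _ _ L] := hF n; have rn := hn0 n nn.
    have : N (F n (w + h) - F n w) <= N (w + h - w).
      apply: L => //; last by lra.
      have := mod_subl (w - z) (- h); rewrite opprK modN (addrAC w); lra.
    rewrite E => L'; rewrite !GS.
    rewrite (_ : _ - _ = (((1 - l) * l ^+ n)%:C)%C * (F n (w + h) - F n w)); last by ring.
    by rewrite modM Nc ler_pM2l.
  have [D hD] : exists D : nat -> C, forall n e, 0 < e -> exists2 d : R, 0 < d & forall h : C,
      N h < d -> N (G n (w + h) - G n w - D n * h) <= e * N h.
    suff : forall n, exists Dn : C, forall e, 0 < e -> exists2 d : R, 0 < d & forall h : C,
        N h < d -> N (G n (w + h) - G n w - Dn * h) <= e * N h.
      by move=> /choice[X hX]; exists X.
    move=> n; have [_ dGn] := aG n; apply/derivable_modP; apply: dGn.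
    by apply/nbhs_modP; exists r0.
  have DD n : (n0 <= n)%N -> N (D n.+1 - D n) <= (1 - l) * l ^+ n.
    move=> nn; apply/ler_addgt0Pr => e e0.
    have e2 : 0 < e / 2 by lra.
    have [d1 d10 h1] := hD n _ e2; have [d2 d20 h2] := hD n.+1 _ e2.
    (* Both first-order expansions are tested at one real increment [t], smaller than all three
       radii. *)
    pose t : R := Num.min r1 (Num.min d1 d2) / 2.
    have m0 : 0 < Num.min r1 (Num.min d1 d2) by rewrite !lt_min r10 d10.
    have : Num.min r1 (Num.min d1 d2) <= Num.min r1 (Num.min d1 d2) by [].
    rewrite !le_min -/t => /and3P[t1 t2 t3].
    have Nt : N ((t%:C)%C : C) = t by rewrite mod_real gtr0_norm// /t; lra.
    have t0 : 0 < t by rewrite /t; lra.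
    have k1 := h1 (t%:C)%C ltac:(rewrite Nt /t; lra).
    have k2 := h2 (t%:C)%C ltac:(rewrite Nt /t; lra).
    have k3 := lip n (t%:C)%C nn ltac:(rewrite Nt /t; lra).
    rewrite Nt in k1 k2 k3.
    have : N ((D n.+1 - D n) * (t%:C)%C) <= ((1 - l) * l ^+ n + e) * t.
      move: k1 k2 k3; set h : C := (t%:C)%C.
      set A := G n (w + h) - G n w; set B := G n.+1 (w + h) - G n.+1 w => k1 k2 k3.
      have -> : (D n.+1 - D n) * h = (B - A) + (A - D n * h) - (B - D n.+1 * h) by ring.
      apply: le_trans (modB _ _) _; have := modD (B - A) (A - D n * h); lra.
    by rewrite modM Nt ler_pM2r.
  have [D' hD'] : exists D' : C, forall k, N (D' - D (n0 + k)%N) <= 2 * l ^+ k.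
    have [L hL] : exists L : C, forall k, N (L - D (n0 + k)%N) <= 2 * 1 * l ^+ k.
      apply: geometric_limit => // k; rewrite addnS mul1r.
      apply: le_trans (DD _ (leq_addr _ _)) _.
      by rewrite ler_pM2l ?subr_gt0.
    by exists L => k; rewrite -[2]mulr1.
  have tail n h : (n0 <= n)%N -> N h < r1 ->
      N ((g (w + h) - g w) - (G n (w + h) - G n w)) <= l ^+ n * N h.
    move=> nn hh.
    have Kwh : K (w + h) by apply: hr0; rewrite addrC addKr; lra.
    have T k : N ((G (n + k)%N (w + h) - G (n + k)%N w) - (G n (w + h) - G n w))
        <= (l ^+ n - l ^+ (n + k)) * N h.
      elim: k => [|k IH]; first by rewrite addn0 !subrr mul0r mod0.
      rewrite addnS; have := lip (n + k)%N h (leq_trans nn (leq_addr _ _)) hh.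
      set A := _ - G (n + k).+1 w; set B := _ - G (n + k)%N w in IH *; set D0 := _ - G n w in IH *.
      have := mod_tri B A D0; rewrite exprS; lra.
    (* The constant collects the error [2 * M] of [g] against [G m] at both end points. *)
    apply: (le_of_geometric l01 (D := 4 * M)); exists n => m /subnKC nE.
    have := T (m - n)%N; rewrite nE; have := hg _ Kw m; have := hg _ Kwh m.
    set A := G m (w + h); set B := G m w; set D0 := _ - G n w.
    have -> : g (w + h) - g w - D0 = (g (w + h) - A) - (g w - B) + (A - B - D0) by ring.
    have := modD ((g (w + h) - A) - (g w - B)) (A - B - D0).
    have := modB (g (w + h) - A) (g w - B).
    have : 0 <= l ^+ m * N h by rewrite mulr_ge0 ?mod_ge0 ?(ltW (lp m)).
    lra.
  apply/derivable_modP; exists D' => e e0.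
  have e2 : 0 < e / 2 by lra.
  (* The 3 is 1 from [tail] plus 2 from [hD']; the other half of [e] is left to the expansion of
     [G (n0 + k)]. *)
  have [k hk] := geometric_small 3 l01 e2.
  have {}hk := hk k (leqnn k).
  have [d d0 hd] := hD (n0 + k)%N _ e2.
  exists (Num.min d r1); first by rewrite lt_min d0.
  move=> h; rewrite lt_min => /andP[/hd h1 /(tail _ _ (leq_addr k n0)) h2].
  have h3 := hD' k.
  have h4 : l ^+ (n0 + k) * N h <= l ^+ k * N h.
    by rewrite ler_wpM2r ?mod_ge0.
  have h5 : N ((D' - D (n0 + k)%N) * h) <= 2 * l ^+ k * N h.
    by rewrite modM ler_wpM2r ?mod_ge0.
  have h6 : 3 * l ^+ k * N h <= e / 2 * N h by rewrite ler_wpM2r ?mod_ge0 ?(ltW hk).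
  move: h1 h2 h5; set A := G (n0 + k)%N (w + h) - _; set B := g _ - _; set Dn := D _.
  move=> h1 h2 h5.
  have -> : B - D' * h = (B - A) + (A - Dn * h) - (D' - Dn) * h by ring.
  have := modB ((B - A) + (A - Dn * h)) ((D' - Dn) * h).
  have := modD (B - A) (A - Dn * h); lra.
Qed.

End Peak.

(** * Primitives of continuous real functions and mean-value estimates *)

Section Primitive.
Local Open Scope ring_scope.
Variable R : realType.
Implicit Types (F G g : R -> R) (a b c d p q E : R).

(** The fundamental theorem is applied strictly to the right of the base point [a], so later uses
    start the integral below the interval of interest. *)
Lemma primitive_exists g a : continuous g ->
  exists F, forall x, a < x -> is_derive x 1 F (g x).
Proof.
move=> cg; exists (fun y => \int[@lebesgue_measure R]_(t in `[a, y]) g t)%R => x ax.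
have xu : x < x + 1 by rewrite ltrDl.
have ig : (@lebesgue_measure R).-integrable `[a, x + 1] (EFin \o g).
  apply: continuous_compact_integrable; first exact: segment_compact.
  exact: continuous_subspaceT.
have := @continuous_FTC1_closed R g a x (x + 1) xu ig ax (cg x).
move=> -[dF EF].
by rewrite -EF derive1E; exact/derivableP.
Qed.

Lemma increment_mean F g c d : c <= d ->
  (forall x, c <= x <= d -> is_derive x 1 F (g x)) ->
  exists2 x, c <= x <= d & F d - F c = g x * (d - c).
Proof.
move=> cd dF; apply: MVT_segment => //.
  by move=> x; rewrite in_itv /= => /andP[h1 h2]; apply: dF; rewrite !ltW.
apply: derivable_within_continuous => x; rewrite in_itv /= => /dF dx.
exact: ex_derive.
Qed.

Lemma increment_bound F g c d E : c <= d ->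
  (forall x, c <= x <= d -> is_derive x 1 F (g x)) ->
  (forall x, c <= x <= d -> `|g x| <= E) ->
  `|F d - F c| <= E * (d - c).
Proof.
move=> cd dF bg; have [x xcd ->] := increment_mean cd dF.
by rewrite normrM (ger0_norm (x := d - c)) ?subr_ge0// ler_wpM2r ?subr_ge0// bg.
Qed.

(** Subtract a primitive of the affine function and apply [increment_bound]. *)
Lemma increment_affine F g c d p q E : c <= d ->
  (forall x, c <= x <= d -> is_derive x 1 F (g x)) ->
  (forall x, c <= x <= d -> `|g x - (p + q * x)| <= E) ->
  `|F d - F c - (p * (d - c) + q * (d ^+ 2 - c ^+ 2) / 2)| <= E * (d - c).
Proof.
move=> cd dF bg.
have := @increment_bound (fun x => F x - (p * x + q / 2 * x ^+ 2))
  (fun x => g x - (p + q * x)) c d E cd _ bg.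
rewrite (_ : F d - _ - _ = F d - F c - (p * (d - c) + q * (d ^+ 2 - c ^+ 2) / 2)); last by field.
apply=> x /dF dFx.
apply: is_deriveB; apply: is_derive_eq.
by rewrite /GRing.scale /=; field.
Qed.

End Primitive.

(** * Goursat's lemma *)

Section Goursat.
Local Open Scope ring_scope.
Variable R : realType.
Implicit Types (a b c d x y e : R).
Variables (u v U V : R -> R -> R) (x0 y0 A B : R).
Hypotheses (A0 : 0 < A) (B0 : 0 < B).

Definition inside x y := (x0 <= x <= x0 + A) && (y0 <= y <= y0 + B).

Hypothesis dU : forall x y, inside x y -> is_derive y 1 (U x) (u x y).
Hypothesis dV : forall x y, inside x y -> is_derive x 1 (V^~ y) (v x y).

(** Joint differentiability of u + iv with complex derivative p + iq, for increments staying in the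
    rectangle and measured by |dx| + |dy|. *)
Definition cauchy_riemann_at x y := exists p q : R, forall e, 0 < e ->
  exists2 d, 0 < d & forall x' y', inside x' y' -> `|x' - x| + `|y' - y| < d ->
    `|u x' y' - u x y - (p * (x' - x) - q * (y' - y))| <= e * (`|x' - x| + `|y' - y|) /\
    `|v x' y' - v x y - (q * (x' - x) + p * (y' - y))| <= e * (`|x' - x| + `|y' - y|).

Hypothesis CR : forall x y, inside x y -> cauchy_riemann_at x y.

(* With [U x] and [V^~ y] primitives of [u x] and [v^~ y], this is the integral of the form
   [u dy + v dx], the imaginary part of [(u + iv)(dx + i dy)], around [a, b] x [c, d]. *)
Definition circ a b c d : R :=
  (U b d - U b c) - (U a d - U a c) - (V b d - V a d) + (V b c - V a c).

(** The affine parts of [u] and [v] make a closed form, whose circulation vanishes. The remaining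
    errors are at most [E], as points of the rectangle differ from (X, Y) by at most twice its width
    and height; the four sides add them up. *)
Lemma circ_bound a b c d X Y (p q e : R) :
  a <= b -> c <= d -> inside a c -> inside b d ->
  `|a - X| <= b - a -> `|c - Y| <= d - c ->
  (forall x y, a <= x <= b -> c <= y <= d ->
    `|u x y - u X Y - (p * (x - X) - q * (y - Y))| <= e * (`|x - X| + `|y - Y|) /\
    `|v x y - v X Y - (q * (x - X) + p * (y - Y))| <= e * (`|x - X| + `|y - Y|)) ->
  0 <= e -> `|circ a b c d| <= 4 * e * ((b - a) + (d - c)) ^+ 2.
Proof.
move=> ab cd iac ibd aX cY h e0.
pose E := e * (2 * ((b - a) + (d - c))).
have hE x y : a <= x <= b -> c <= y <= d -> e * (`|x - X| + `|y - Y|) <= E.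
  move=> xab ycd; rewrite ler_wpM2l//.
  have h1 : `|x - X| <= 2 * (b - a) by move: aX; rewrite !ler_norml; lra.
  have h2 : `|y - Y| <= 2 * (d - c) by move: cY; rewrite !ler_norml; lra.
  lra.
have ins x y : a <= x <= b -> c <= y <= d -> inside x y.
  by move: iac ibd; rewrite /inside; lra.
have aab : a <= a <= b by rewrite lexx.
have bab : a <= b <= b by rewrite lexx andbT.
have ccd : c <= c <= d by rewrite lexx.
have dcd : c <= d <= d by rewrite lexx andbT.
have Uinc x : a <= x <= b ->
    `|U x d - U x c - ((u X Y + p * (x - X) + q * Y) * (d - c) + - q * (d ^+ 2 - c ^+ 2) / 2)|
      <= E * (d - c).
  move=> xab; apply: increment_affine => // y ycd; first exact/dU/ins.
  apply: le_trans (hE x y xab ycd); apply: le_trans (h x y xab ycd).1.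
  by rewrite le_eqVlt; apply/orP; left; apply/eqP; congr (`|_|); ring.
have Vinc y : c <= y <= d ->
    `|V b y - V a y - ((v X Y + p * (y - Y) - q * X) * (b - a) + q * (b ^+ 2 - a ^+ 2) / 2)|
      <= E * (b - a).
  move=> ycd; apply: (@increment_affine R (V^~ y) (v^~ y)) => // x xab; first exact/dV/ins.
  apply: le_trans (hE x y xab ycd); apply: le_trans (h x y xab ycd).2.
  by rewrite le_eqVlt; apply/orP; left; apply/eqP; congr (`|_|); ring.
have -> : 4 * e * ((b - a) + (d - c)) ^+ 2 =
  E * (d - c) + E * (d - c) + E * (b - a) + E * (b - a) by rewrite /E; ring.
have := Uinc b bab; have := Uinc a aab; have := Vinc d dcd; have := Vinc c ccd.
rewrite /circ !ler_norml; move: (E * (b - a)) (E * (d - c)) => E1 E2; lra.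
Qed.

Lemma circ_quarter a b c d (h k : R) :
  circ a b c d = circ a h c k + circ h b c k + (circ a h k d + circ h b k d).
Proof. by rewrite /circ; ring. Qed.

(** The four quarters sum to the whole, so they cannot all be below a quarter of it. *)
Lemma bisection_step x y (s t : R) :
  exists p : R * R, [/\ p.1 = x \/ p.1 = x + s, p.2 = y \/ p.2 = y + t &
    `|circ x (x + s + s) y (y + t + t)| <= 4 * `|circ p.1 (p.1 + s) p.2 (p.2 + t)|].
Proof.
apply: contrapT => hno.
set T := `|circ x (x + s + s) y (y + t + t)| in hno *.
have small x' y' : x' = x \/ x' = x + s -> y' = y \/ y' = y + t ->
    4 * `|circ x' (x' + s) y' (y' + t)| < T.
  move=> hx hy; rewrite ltNge; apply/negP => hT; apply: hno; exists (x', y'); split=> //.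
have h1 := small x y (or_introl erefl) (or_introl erefl).
have h2 := small (x + s) y (or_intror erefl) (or_introl erefl).
have h3 := small x (y + t) (or_introl erefl) (or_intror erefl).
have h4 := small (x + s) (y + t) (or_intror erefl) (or_intror erefl).
have : T <= `|circ x (x + s) y (y + t)| + `|circ (x + s) (x + s + s) y (y + t)| +
  (`|circ x (x + s) (y + t) (y + t + t)| + `|circ (x + s) (x + s + s) (y + t) (y + t + t)|).
  rewrite /T (@circ_quarter x _ y _ (x + s) (y + t)).
  apply: le_trans (ler_normD _ _) _; apply: lerD; exact: ler_normD.
lra.
Qed.

(** Bisection yields rectangles scaled by 2^-n whose circulation is at least 4^-n of the original
    one in modulus. They close in on a point, where differentiability makes the circulation
    o(4^-n). *)
Lemma goursat : circ x0 (x0 + A) y0 (y0 + B) = 0.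
Proof.
have half01 : 0 < (1 / 2 : R) < 1 by lra.
set l : R := 1 / 2 in half01.
have [l0 l1] := andP half01.
have lp n : 0 < l ^+ n by exact: exprn_gt0.
have lS n : l ^+ n = l ^+ n.+1 + l ^+ n.+1 by rewrite exprS /l; field.
have [st hst] : exists st : nat * (R * R) -> R * R, forall np, let: (n, p) := np in
    [/\ (st np).1 = p.1 \/ (st np).1 = p.1 + A * l ^+ n.+1,
        (st np).2 = p.2 \/ (st np).2 = p.2 + B * l ^+ n.+1 &
    `|circ p.1 (p.1 + A * l ^+ n) p.2 (p.2 + B * l ^+ n)| <=
     4 * `|circ (st np).1 ((st np).1 + A * l ^+ n.+1) (st np).2 ((st np).2 + B * l ^+ n.+1)|].
  suff : forall np : nat * (R * R), exists r : R * R, let: (n, p) := np in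
    [/\ r.1 = p.1 \/ r.1 = p.1 + A * l ^+ n.+1, r.2 = p.2 \/ r.2 = p.2 + B * l ^+ n.+1 &
    `|circ p.1 (p.1 + A * l ^+ n) p.2 (p.2 + B * l ^+ n)| <=
     4 * `|circ r.1 (r.1 + A * l ^+ n.+1) r.2 (r.2 + B * l ^+ n.+1)|].
    by move=> /choice[X hX]; exists X.
  move=> [n p]; rewrite (lS n) !mulrDr !addrA; exact: bisection_step.
(* [Q n] is the lower left corner of the n-th rectangle, of sides [A * l ^+ n] and [B * l ^+ n]. *)
pose Q := fix Q n := if n is m.+1 then st (m, Q m) else (x0, y0).
have QS n := hst (n, Q n); rewrite /= in QS.
have inQ n : [/\ x0 <= (Q n).1, (Q n).1 + A * l ^+ n <= x0 + A,
    y0 <= (Q n).2 & (Q n).2 + B * l ^+ n <= y0 + B].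
  elim: n => [|n [h1 h2 h3 h4]]; first by rewrite expr0 !mulr1; split.
  have := mulr_gt0 A0 (lp n.+1); have := mulr_gt0 B0 (lp n.+1).
  have [hx hy _] := QS n; rewrite (lS n) !mulrDr in h2 h4.
  by case: hx => -> ; case: hy => ->; split; lra.
have big n : `|circ x0 (x0 + A) y0 (y0 + B)| <=
    4 ^+ n * `|circ (Q n).1 ((Q n).1 + A * l ^+ n) (Q n).2 ((Q n).2 + B * l ^+ n)|.
  elim: n => [|n IH]; first by rewrite expr0 !mulr1 mul1r.
  have [_ _ h] := QS n; apply: le_trans IH _.
  by rewrite exprSr -mulrA ler_wpM2l// exprn_ge0.
have halfE n (D : R) : D * ((1 - l) * l ^+ n) = D * l ^+ n.+1 by rewrite exprS /l; field.
have [X hX] : exists X, forall n, `|X - (Q n).1| <= A * l ^+ n.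
  apply: geometric_limit_real => // n; rewrite halfE.
  have := mulr_gt0 A0 (lp n.+1); have [hx _ _] := QS n.
  by case: hx => ->; rewrite ler_norml; lra.
have [Y hY] : exists Y, forall n, `|Y - (Q n).2| <= B * l ^+ n.
  apply: geometric_limit_real => // n; rewrite halfE.
  have := mulr_gt0 B0 (lp n.+1); have [_ hy _] := QS n.
  by case: hy => ->; rewrite ler_norml; lra.
have iXY : inside X Y.
  rewrite /inside; apply/andP; split; apply/andP; split.
  - apply: (le_of_geometric half01 (D := A)); exists 0%N => n _.
    by have := hX n; have [] := inQ n; rewrite ler_norml; lra.
  - apply: (le_of_geometric half01 (D := A)); exists 0%N => n _.
    by have := hX n; have := mulr_gt0 A0 (lp n); have [] := inQ n; rewrite ler_norml; lra.
  - apply: (le_of_geometric half01 (D := B)); exists 0%N => n _.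
    by have := hY n; have [] := inQ n; rewrite ler_norml; lra.
  - apply: (le_of_geometric half01 (D := B)); exists 0%N => n _.
    by have := hY n; have := mulr_gt0 B0 (lp n); have [] := inQ n; rewrite ler_norml; lra.
have [p [q hCR]] := CR iXY.
apply/eqP; rewrite -normr_le0; apply/ler_addgt0Pr => e e0; rewrite add0r.
have AB0 : 0 < 4 * (A + B) ^+ 2 by rewrite mulr_gt0// exprn_gt0// addr_gt0.
pose e' := e / (4 * (A + B) ^+ 2).
have e'0 : 0 < e' by rewrite divr_gt0.
have [d d0 hd] := hCR e' e'0.
have [n0 /(_ n0 (leqnn _)) hn0] := geometric_small (2 * (A + B)) half01 d0.
have [i1 i2 i3 i4] := inQ n0.
have An := mulr_gt0 A0 (lp n0); have Bn := mulr_gt0 B0 (lp n0).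
apply: le_trans (big n0) _.
have E : 4 ^+ n0 * (l ^+ n0 * l ^+ n0) = 1.
  by rewrite -exprMn -exprMn (_ : 4 * _ = 1) ?expr1n// /l; field.
have -> : e = 4 ^+ n0 * (4 * e' * ((A + B) * l ^+ n0) ^+ 2).
  transitivity (4 * e' * (A + B) ^+ 2 * (4 ^+ n0 * (l ^+ n0 * l ^+ n0))); last by ring.
  rewrite E mulr1 /e'; field; rewrite lt0r_neq0//; lra.
rewrite ler_wpM2l ?exprn_ge0//.
have -> : (A + B) * l ^+ n0 = ((Q n0).1 + A * l ^+ n0 - (Q n0).1) +
   ((Q n0).2 + B * l ^+ n0 - (Q n0).2) by ring.
have hx := hX n0; have hy := hY n0.
apply: (@circ_bound _ _ _ _ X Y p q); rewrite ?lerDl ?(ltW An) ?(ltW Bn) ?(ltW e'0)//.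
- by rewrite /inside; lra.
- by rewrite /inside; lra.
- by rewrite addrAC subrr add0r distrC.
- by rewrite addrAC subrr add0r distrC.
move=> x y xQ yQ; apply: hd; first by rewrite /inside; lra.
have : `|x - X| <= 2 * (A * l ^+ n0) by move: hx; rewrite !ler_norml; lra.
have : `|y - Y| <= 2 * (B * l ^+ n0) by move: hy; rewrite !ler_norml; lra.
lra.
Qed.

End Goursat.

(** * Circular means *)

Section Exponential.
Local Open Scope ring_scope.
Variable R : realType.
Local Notation C := (Cplx R).
Local Notation N := (@Normc.normc R).
Local Notation Re := (@complex.Re R).
Local Notation Im := (@complex.Im R).
Implicit Types (c w z : C) (f : C -> C) (a b d e r x y : R).

Lemma is_derive_approx (F : R -> R) x (l : R) : is_derive x 1 F l ->
  forall e, 0 < e -> exists2 d, 0 < d & forall h, `|h| < d ->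
    `|F (x + h) - F x - l * h| <= e * `|h|.
Proof.
move=> [dF <-] e e0.
have : nbhs (0 : R)^' [set h : R | `|'D_1 F x - h^-1 *: (F (h *: 1 + x) - F x)| < e].
  by apply: (dF [set t : R | `|'D_1 F x - t| < e]); exact: (nbhsx_ballx _ e).
move=> [d /= d0 hd]; exists d => // h hh.
have [->|h0] := eqVneq h 0; first by rewrite addr0 subrr mulr0 subr0 !normr0 mulr0.
have := hd h; rewrite /= sub0r normrN => /(_ hh h0) /ltW.
rewrite -(@ler_pM2r _ `|h|) ?normr_gt0// -normrM -normrN; congr (`|_| <= _).
by rewrite /GRing.scale /= mulr1 (addrC h) mulrBl opprB mulrAC mulVf// mul1r.
Qed.

Definition cexp x y : C := Complex (expR x * cos y) (expR x * sin y).

Lemma mod_cexp x y : N (cexp x y) = expR x.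
Proof.
by rewrite /= !exprMn -mulrDr cos2Dsin2 mulr1 sqrtr_sqr ger0_norm ?expR_ge0.
Qed.

Lemma cexpD a b x y : cexp (x + a) (y + b) = cexp x y * cexp a b.
Proof.
rewrite /cexp expRD cosD sinD; apply/eqP; rewrite eq_complex /=.
by apply/andP; split; apply/eqP; ring.
Qed.

Lemma cexp_approx0 e : 0 < e -> exists2 d, 0 < d & forall a b, `|a| + `|b| < d ->
  N (cexp a b - 1 - Complex a b) <= e * (`|a| + `|b|).
Proof.
(* The errors below total at most [7 * t] times |a| + |b|. The bound [t <= 1] gives |exp a - 1| <= 2
   |a|, which is at most [t] because |a| < t / 2. *)
move=> e0; pose t := Num.min (e / 10) 1.
have t0 : 0 < t by rewrite lt_min ltr01 andbT; lra.
have : t <= t by []; rewrite {2}/t le_min => /andP[t1 t2].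
have [d1 d10 h1] := is_derive_approx (is_derive_expR (0 : R)) t0.
have [d2 d20 h2] := is_derive_approx (is_derive_cos (0 : R)) t0.
have [d3 d30 h3] := is_derive_approx (is_derive_sin (0 : R)) t0.
exists (Num.min (Num.min d1 d2) (Num.min d3 (t / 2))).
  by rewrite !lt_min d10 d20 d30 /=; lra.
move=> a b; rewrite !lt_min => /andP[/andP[k1 k2] /andP[k3 k4]].
have na := normr_ge0 a; have nb := normr_ge0 b.
have := h1 a; have := h2 b; have := h3 b.
rewrite !add0r expR0 cos0 sin0 oppr0 mul0r !subr0 !addr0 !mul1r.
have kb : `|b| < d3 by lra.
have kb' : `|b| < d2 by lra.
have ka : `|a| < d1 by lra.
move=> /(_ kb) s3 /(_ kb') s2 /(_ ka) s1.
have ea : `|expR a - 1| <= 2 * `|a|.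
  rewrite (_ : expR a - 1 = (expR a - 1 - a) + a); last by ring.
  apply: le_trans (ler_normD _ _) _; have : t * `|a| <= 1 * `|a| by rewrite ler_wpM2r.
  by rewrite mul1r; lra.
have e2 : `|expR a| <= 3.
  rewrite (_ : expR a = (expR a - 1) + 1); last by ring.
  by apply: le_trans (ler_normD _ _) _; rewrite normr1; lra.
apply: le_trans (mod_ReIm _) _; rewrite /= subr0.
have -> : expR a * cos b - 1 - a = (expR a - 1 - a) + expR a * (cos b - 1) by ring.
have -> : expR a * sin b - b = expR a * (sin b - b) + (expR a - 1) * b by ring.
have r1 : `|(expR a - 1 - a) + expR a * (cos b - 1)| <= t * `|a| + 3 * (t * `|b|).
  apply: le_trans (ler_normD _ _) _; apply: lerD => //.
  by rewrite normrM; apply: ler_pM.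
have r2 : `|expR a * (sin b - b) + (expR a - 1) * b| <= 3 * (t * `|b|) + t * `|b|.
  apply: le_trans (ler_normD _ _) _; rewrite !normrM; apply: lerD; apply: ler_pM => //; lra.
have : (10 * t) * (`|a| + `|b|) <= e * (`|a| + `|b|) by rewrite ler_wpM2r ?addr_ge0//; lra.
have : 0 <= t * `|a| by rewrite mulr_ge0 ?(ltW t0).
have : 0 <= t * `|b| by rewrite mulr_ge0 ?(ltW t0).
lra.
Qed.

Lemma mod_Complex a b : N (Complex a b) <= `|a| + `|b|.
Proof. exact: mod_ReIm. Qed.

(** Chain rule in the real coordinates of [cauchy_riemann_at]; the addition formula reduces it to
    the expansion of exp at 0. *)
Lemma comp_cexp_approx f z x y : derivable f (z + cexp x y) 1 ->
  exists P : C, forall e, 0 < e -> exists2 d, 0 < d & forall x' y',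
    `|x' - x| + `|y' - y| < d ->
    N (f (z + cexp x' y') - f (z + cexp x y) - P * Complex (x' - x) (y' - y))
      <= e * (`|x' - x| + `|y' - y|).
Proof.
move=> /derivable_modP[L hL]; exists (L * cexp x y) => e e0.
set E := expR x; have E0 : 0 < E by exact: expR_gt0.
have L0 := mod_ge0 L.
(* The increment of exp is at most [2 * E * S], so this tolerance costs [e / 2]; [t] makes the error
   of exp cost the other half, with [N L + 1] guarding against [L = 0]. *)
have [d1 d10 h1] := hL (e / (4 * E)) ltac:(apply: divr_gt0; lra).
pose t := Num.min 1 (e / (2 * (N L + 1) * E)).
have t0 : 0 < t.
  by rewrite lt_min ltr01 /= divr_gt0// mulr_gt0// mulr_gt0//; lra.
have : t <= t by []; rewrite {2}/t le_min => /andP[t1 t2].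
have [d2 d20 h2] := cexp_approx0 t0.
exists (Num.min d2 (d1 / (2 * E))); first by rewrite lt_min d20 divr_gt0//; lra.
move=> x' y'; rewrite lt_min; set a := x' - x; set b := y' - y.
rewrite ltr_pdivlMr; last by lra.
move=> /andP[/h2 k2 k1].
have -> : x' = x + a by rewrite /a; ring.
have -> : y' = y + b by rewrite /b; ring.
have S0 : 0 <= `|a| + `|b| by rewrite addr_ge0.
set S := `|a| + `|b| in k1 k2 S0 *.
set c := cexp x y; set n := cexp a b - 1 - Complex a b in k2.
set k := cexp (x + a) (y + b) - c.
have kE : k = c * (Complex a b + n).
  by rewrite /k cexpD -/c /n; move: (cexp a b) (Complex a b : C) => s m; ring.
have Nn : N n <= S by apply: le_trans k2 _; rewrite ler_piMl.
have Nk : N k <= 2 * E * S.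
  rewrite kE modM mod_cexp -/E (_ : 2 * E * S = E * (2 * S)) ?ler_pM2l//; last by ring.
  by apply: le_trans (modD _ _) _; have := mod_Complex a b; rewrite -/S; lra.
have := h1 k ltac:(lra).
rewrite (_ : z + c + k = z + cexp (x + a) (y + b)); last by rewrite /k; ring.
set D := f _ - f _ => hD.
have -> : D - L * c * Complex a b = (D - L * k) + L * c * n by rewrite kE; ring.
apply: le_trans (modD _ _) _.
have b1 : N (D - L * k) <= e / 2 * S.
  apply: le_trans hD _; apply: (@le_trans _ _ (e / (4 * E) * (2 * E * S))).
    by rewrite ler_wpM2l// divr_ge0; lra.
  by rewrite le_eqVlt; apply/orP; left; apply/eqP; field; rewrite lt0r_neq0.
have b2 : N (L * c * n) <= e / 2 * S.
  rewrite !modM mod_cexp -/E.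
  apply: (@le_trans _ _ ((N L + 1) * E * (e / (2 * (N L + 1) * E) * S))).
    apply: ler_pM; rewrite ?mulr_ge0 ?mod_ge0 ?(ltW E0)//.
      by rewrite ler_pM2r//; lra.
    by apply: le_trans k2 _; rewrite ler_wpM2r.
  by rewrite le_eqVlt; apply/orP; left; apply/eqP; field; rewrite !lt0r_neq0//; lra.
lra.
Qed.

End Exponential.

(** * The maximum principle for the real part at the centre of a disk *)

Section Disk.
Local Open Scope ring_scope.
Variable R : realType.
Local Notation C := (Cplx R).
Local Notation N := (@Normc.normc R).
Local Notation Re := (@complex.Re R).
Local Notation Im := (@complex.Im R).
Implicit Types (c w z : C) (f : C -> C) (a b d e r x y : R).

Lemma continuous_eps_delta (g : R -> R) :
  (forall x e, 0 < e -> exists2 d, 0 < d & forall x', `|x' - x| < d -> `|g x' - g x| < e) ->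
  continuous g.
Proof.
move=> h x A /nbhs_ballP[e /= e0 hA]; have [d d0 hd] := h x e e0.
apply/nbhs_ballP; exists d => //= x' xx'; apply: hA; rewrite /ball /= distrC.
by apply: hd; rewrite distrC.
Qed.

Lemma derivable_cts f w : derivable f w 1 -> cts_at f w.
Proof.
move=> /derivable_modP[l hl]; apply/cts_atP => e e0.
have [d d0 hd] := hl 1 ltr01; have l0 := mod_ge0 l.
have p : 0 < N l + 1 by lra.
exists (Num.min d (e / (N l + 1))); first by rewrite lt_min d0 divr_gt0.
move=> x; rewrite lt_min ltr_pdivlMr// => /andP[/hd].
rewrite (_ : w + (x - w) = x); last by ring.
have := mod_subl (f x - f w) (l * (x - w)); rewrite modM; lra.
Qed.

(** In logarithmic coordinates, Goursat on [x0, X] x [0, 2 pi] equates the integrals of Re f over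
    the circles of radii exp x0 and r. If Re (f z) exceeded [m], then so would Re f on a small
    enough inner circle, a contradiction. *)
Lemma Re_center_le f z r m : 0 < r ->
  (forall w, N (w - z) <= r -> derivable f w 1) ->
  (forall w, N (w - z) = r -> Re (f w) <= m) -> Re (f z) <= m.
Proof.
move=> r0 df hm; rewrite leNgt; apply/negP => mz.
have e0 : 0 < (Re (f z) - m) / 2 by lra.
have cz : cts_at f z by apply: derivable_cts; apply: df; rewrite subrr mod0 ltW.
have [d d0 hd] := (cts_atP _ _).1 cz _ e0.
have sE x y : z + cexp x y - z = cexp x y by rewrite addrAC subrr add0r.
pose X := ln r; have EX : expR X = r by rewrite lnK.
have [x0 [x0X x0d]] : exists x0, x0 < X /\ expR x0 < d.
  have p : 0 < Num.min r d / 2 by rewrite divr_gt0// lt_min r0.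
  exists (ln (Num.min r d / 2)); rewrite lnK//.
  have q : 0 < Num.min r d by rewrite lt_min r0.
  have : Num.min r d <= d by rewrite ge_min lexx orbT.
  have : Num.min r d <= r by rewrite ge_min lexx.
  rewrite /X; split; [rewrite ltr_ln//; lra|lra].
pose T : R := pi *+ 2; have T0 : 0 < T by rewrite pmulrn_lgt0// pi_gt0.
have derX x y : x <= X -> derivable f (z + cexp x y) 1.
  by move=> xX; apply: df; rewrite sE mod_cexp -EX ler_expR.
(* Differentiability is given for [x <= X]; freezing [x] at [X] beyond makes the integrand
   continuous on the whole line, as the primitives require. *)
pose m1 x := Num.min x X.
have m1X x : m1 x <= X by rewrite ge_min lexx orbT.
have m1E x : x <= X -> m1 x = x by move=> xX; rewrite /m1 min_l.
have m1L x x' : `|m1 x' - m1 x| <= `|x' - x|.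
  by rewrite /m1 /Num.min; case: ltP => h1; case: ltP => h2; rewrite !ler_norml;
    have := ler_norm (x' - x); have := ler_norm (x - x'); rewrite (distrC x); lra.
pose F x y := f (z + cexp (m1 x) y).
pose u x y := Re (F x y); pose v x y := Im (F x y).
have cF x y e : 0 < e -> exists2 d, 0 < d & forall x' y', `|x' - x| + `|y' - y| < d ->
    N (F x' y' - F x y) < e.
  move=> e00; have [P hP] := comp_cexp_approx (derX _ y (m1X x)).
  have [d1 d10 h1] := hP 1 ltr01; have P0 := mod_ge0 P.
  have p : 0 < N P + 2 by lra.
  exists (Num.min d1 (e / (N P + 2))); first by rewrite lt_min d10 divr_gt0.
  move=> x' y'; rewrite lt_min ltr_pdivlMr// => /andP[k1 k2].
  have hx := m1L x x'.
  have := h1 (m1 x') y' ltac:(lra); rewrite -/(F x' y') -/(F x y) => h.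
  have := mod_subl (F x' y' - F x y) (P * Complex (m1 x' - m1 x) (y' - y)).
  rewrite modM => hs.
  have hc : N P * N (Complex (m1 x' - m1 x) (y' - y)) <= N P * (`|x' - x| + `|y' - y|).
    by rewrite ler_wpM2l//; apply: le_trans (mod_Complex _ _) _; rewrite lerD2r.
  have := normr_ge0 (x' - x); have := normr_ge0 (y' - y); lra.
have [U hU] : exists U : R -> R -> R, forall x y, -1 < y -> is_derive y 1 (U x) (u x y).
  suff : forall x, exists Ux : R -> R, forall y, -1 < y -> is_derive y 1 Ux (u x y).
    by move=> /choice[W hW]; exists W.
  move=> x; apply: primitive_exists; apply: continuous_eps_delta => y e e00.
  have [d1 d10 h1] := cF x y e e00; exists d1 => // y' yy.
  rewrite /u -ReB; apply: le_lt_trans (mod_Re _) _; apply: h1.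
  by rewrite subrr normr0 add0r.
have [V hV] : exists V : R -> R -> R, forall y x, x0 - 1 < x -> is_derive x 1 (V y) (v x y).
  suff : forall y, exists Vy : R -> R, forall x, x0 - 1 < x -> is_derive x 1 Vy (v x y).
    by move=> /choice[W hW]; exists W.
  move=> y; apply: primitive_exists; apply: continuous_eps_delta => x e e00.
  have [d1 d10 h1] := cF x y e e00; exists d1 => // x' xx.
  rewrite /v (_ : Im _ - Im _ = Im (F x' y - F x y)); last by case: (F x' y) (F x y) => ? ? [].
  apply: le_lt_trans (mod_Im _) _; apply: h1.
  by rewrite subrr normr0 addr0.
pose A := X - x0; have A0 : 0 < A by rewrite subr_gt0.
have AE : x0 + A = X by rewrite /A addrC subrK.
have := @goursat R u v U (fun x y => V y x) x0 0 A T A0 T0.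
rewrite AE add0r => gs.
have {gs} : circ U (fun x y => V y x) x0 X 0 T = 0.
  apply: gs.
  - by move=> x y; rewrite /inside => h; apply: hU; lra.
  - by move=> x y; rewrite /inside => h; apply: hV; lra.
  move=> x y; rewrite /inside AE => h.
  have xX : x <= X by lra.
  have [[p q] hP] := comp_cexp_approx (derX x y xX).
  exists p, q => e /hP[d1 d10 h1]; exists d1 => // x' y'.
  rewrite /inside AE => h' /h1; rewrite /u /v /F !m1E//; last by lra.
  move=> h2; split; apply: le_trans h2.
    apply: le_trans (mod_Re _); rewrite le_eqVlt; apply/orP; left; apply/eqP; congr (`|_|).
    by case: (f _) (f _) => ? ? [? ?] /=.
  apply: le_trans (mod_Im _); rewrite le_eqVlt; apply/orP; left; apply/eqP; congr (`|_|).
  by case: (f _) (f _) => ? ? [? ?] /=; rewrite [_ + p * _]addrC.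
have vper x : v x T = v x 0.
  by rewrite /v /F /cexp /T cos2pi sin2pi cos0 sin0.
have x0X' := ltW x0X.
(* By periodicity [V T - V 0] has zero derivative, so the horizontal sides cancel. *)
have : `|(V T X - V 0 X) - (V T x0 - V 0 x0)| <= 0 * (X - x0).
  apply: (@increment_bound R (fun x => V T x - V 0 x) (fun x => v x T - v x 0)) => // x xx.
    by apply: is_deriveB; apply: hV; lra.
  by rewrite vper subrr normr0.
rewrite mul0r normr_le0 => /eqP EV.
have Tp := ltW T0.
(* Each vertical integral is [T] times a value of Re f on the corresponding circle. *)
have [y1 y1T EU1] : exists2 y, 0 <= y <= T & U X T - U X 0 = u X y * (T - 0).
  by apply: increment_mean => // y yT; apply: hU; lra.
have [y2 y2T EU2] : exists2 y, 0 <= y <= T & U x0 T - U x0 0 = u x0 y * (T - 0).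
  by apply: increment_mean => // y yT; apply: hU; lra.
have u1 : u X y1 <= m by rewrite /u /F m1E//; apply: hm; rewrite sE mod_cexp.
have u2 : m < u x0 y2.
  rewrite /u /F m1E//.
  have : N (z + cexp x0 y2 - z) < d by rewrite sE mod_cexp.
  by move/hd/(le_lt_trans (mod_Re _)); rewrite ReB ltr_norml; lra.
rewrite /circ EU1 EU2 subr0.
have : u X y1 * T < u x0 y2 * T by rewrite ltr_pM2r//; lra.
move: EV; lra.
Qed.

End Disk.

(** * The three implications *)

Section Equivalence.
Local Open Scope ring_scope.
Variable R : realType.
Local Notation C := (Cplx R).
Local Notation N := (@Normc.normc R).
Local Notation Re := (@complex.Re R).
Implicit Types (K A : set C) (f : C -> C) (w z : C).

Lemma compact_mod_max A f : compact A -> {within A, continuous f} -> A !=set0 ->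
  exists2 c, A c & forall w, A w -> N (f w) <= N (f c).
Proof.
move=> cA cf A0.
have cN : {within A, continuous (fun w => N (f w))}.
  apply/subspace_continuousP => w Aw B /nbhs_ballP[e /= e0 hB].
  have [d d0 hd] := (within_modP _ _).1 cf w Aw e e0.
  apply/nbhs_modP; exists d => // x xw Ax; apply: hB; rewrite /ball /= /from_subspace.
  apply: le_lt_trans (hd x Ax xw); rewrite ler_norml.
  have := mod_subl (f x) (f w); have := mod_subl (f w) (f x).
  rewrite (modBC (f w)); lra.
by have [c Ac hc] := compact_EVT_max A0 cA cN; exists c => [|w Aw];
  [rewrite inE in Ac|apply: hc; rewrite inE].
Qed.

Lemma compact_closed_mod A : compact A -> closed A.
Proof. by apply: compact_closed; exact: norm_hausdorff. Qed.

Lemma boundary_peak K z : compact K -> connected (~` K) -> K z ->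
  boundary K z -> peak_point K z.
Proof.
move=> cK cn Kz [_ iz].
have [c _ hc] := @compact_mod_max K id cK (continuous_subspaceT (fun=> cvg_id)) (ex_intro _ z Kz).
have [M M0 hM] := boundary_functions (compact_closed_mod cK) hc cn Kz iz.
(* The ratio will be 1 - 1 / (2 (M + 1)), for which (1 - l) M = M / (2 (M + 1)) is at most 1/2. *)
have p : 0 < 2 * (M + 1) by rewrite mulr_gt0//; lra.
have i2 : (2 * (M + 1))^-1 <= 1 / 2.
  by rewrite div1r lef_pV2 ?posrE//; lra.
have i0 : 0 < (2 * (M + 1))^-1 by rewrite invr_gt0.
have l01 : 0 < 1 - (2 * (M + 1))^-1 < 1 by lra.
apply: (@peak_of_concentrated R K z M _ Kz l01) => //.
by rewrite opprB addrC subrK mulrC ler_pdivrMr//; lra.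
Qed.

Lemma algA_X K f n : algA K f -> algA K (fun w => f w ^+ n).
Proof.
move=> af; elim: n => [|n IH].
  by under eq_fun do rewrite expr0; exact: algA_cst.
under eq_fun do rewrite exprS; exact: (algA_M af IH).
Qed.

Lemma peak_bishop K z : compact K -> peak_point K z -> bishop_quarter K z.
Proof.
move=> cK [Kz [f af [fz f1]]]; split=> // U [oU Uz].
have f1' w : K w -> N (f w) <= 1.
  move=> Kw; have [->|wz] := eqVneq w z; first by rewrite fz mod1.
  have : (K `\ z) w by split=> //; exact/eqP.
  by move/f1; rewrite normrC ltcR => /ltW.
(* Compactness gives a maximum of |f| below 1 off [U]. An empty difference takes 1/2, and the
   maximum with 1/2 keeps [q] positive for [geometric_small]. *)
have [q [q0 q1 hq]] : exists q : R, [/\ 0 < q, q < 1 & forall w, (K `\` U) w -> N (f w) <= q].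
  have [A0|A0] := pselect ((K `\` U) !=set0); last first.
    by exists (1 / 2); split=> [||w Aw]; [lra|lra|case: A0; exists w].
  have cA : compact (K `\` U).
    by rewrite setDE; apply: compact_closedI => //; exact: open_closedC.
  have cf : {within K `\` U, continuous f}.
    by apply: continuous_subspaceW af.1; exact: subDsetl.
  have [c [Kc Uc] hc] := compact_mod_max cA cf A0.
  have c1 : N (f c) < 1.
    have /f1 : (K `\ z) c by split=> // cz; apply: Uc; rewrite cz.
    by rewrite normrC ltcR.
  exists (Num.max (N (f c)) (1 / 2)); split.
  - by rewrite lt_max; apply/orP; right; lra.
  - by rewrite gt_max c1; lra.
  - by move=> w /hc h; rewrite le_max h.
have q01 : 0 < q < 1 by rewrite q0.
have q4 : 0 < 1 / 4 :> R by lra.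
have [n /(_ n (leqnn n))] := geometric_small 1 q01 q4; rewrite mul1r => hn.
exists (fun w => f w ^+ n); first exact: algA_X.
split.
- apply: ge_sup; first by exists (N (f z ^+ n)); exists z.
  by move=> _ [w Kw <-]; rewrite modX exprn_ile1 ?mod_ge0 ?f1'.
- by rewrite fz expr1n real1.
- by rewrite fz expr1n ltr_pdivrMr// mul1r ltr_nat.
- move=> w Aw; have -> : (1 / 4 : C) = ((1 / 4)%:C)%C by rewrite rmorphM fmorphV rmorph1 rmorph_nat.
  rewrite normrC ltcR modX; apply: le_lt_trans hn.
  by rewrite lerXn2r ?nnegrE ?mod_ge0 ?(ltW q0)// hq.
Qed.

Lemma bishop_boundary K z : bishop_quarter K z -> boundary K z.
Proof.
move=> [Kz hz]; split; first exact: subset_closure.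
move=> iz; have : nbhs z (interior K) by exact: nbhs_interior.
move=> /nbhs_modP[r r0 hr].
(* Halving the radius puts the circle |w - z| = r / 2 in the interior of [K] yet outside [U], so |f|
   < 1/4 on it. *)
pose U := [set w : C | N (w - z) < r / 2].
have oU : open_nbhs z U.
  split; last by rewrite /U /= subrr mod0; lra.
  rewrite openE => w /= wU; apply/nbhs_modP; exists (r / 2 - N (w - z)); first by rewrite subr_gt0.
  by move=> x; rewrite /U /= => xw; have := mod_tri w x z; lra.
have [f [_ df] [_ fr fz fU]] := hz U oU.
have r2 : 0 < r / 2 by lra.
have : Re (f z) <= 1 / 4.
  apply: (@Re_center_le R f z _ _ r2) => w wr.
    by apply: df; apply: hr; lra.
  have Aw : (K `\` U) w.
    by split; [apply: interior_subset; apply: hr; lra|rewrite /U /= wr ltxx].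
  have := fU w Aw; have -> : (1 / 4 : C) = ((1 / 4)%:C)%C.
    by rewrite rmorphM fmorphV rmorph1 rmorph_nat.
  by rewrite normrC ltcR => /ltW; exact: le_trans (Re_le_mod _).
move: fz; have -> : (3 / 4 : C) = ((3 / 4)%:C)%C by rewrite rmorphM fmorphV !rmorph_nat.
by rewrite ltcE /= => /andP[_]; lra.
Qed.

End Equivalence.

Theorem theorem10p2 (R : realType) (K : set (Cplx R)) (z : Cplx R) :
  compact K -> connected (~` K) -> K z ->
  [<-> boundary K z; peak_point K z; bishop_quarter K z].
Proof.
move=> cK cn Kz; split; [exact: boundary_peak|split; [exact: peak_bishop|exact: bishop_boundary]].
Qed.
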